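(* Let $P\subset\mathbb{R}^3$ be a compact convex polyhedron with triangular faces, with $0$ in its interior and with vertices $p_1,\dots,p_n$, and let $r^0=(\|p_1\|,\dots,\|p_n\|)$. Let $\kappa=(\kappa_1,\dots,\kappa_n)$ be the curvatures of the warped polyhedra $P(r)$, as functions of $r$ near $r^0$. Then $P$ is infinitesimally rigid if and only if $$\dim\ker\left.\left(\frac{\partial\kappa_i}{\partial r_j}\right)\right|_{r=r^0}=3 .$$
   Context: Infinitesimal rigidity: an isometric infinitesimal deformation of $P$ is a collection of vectors $q_1,\dots,q_n\in\mathbb{R}^3$ with $\langle p_i-p_j,q_i-q_j\rangle=0$ for all edges $p_ip_j$ of $P$. It is trivial if $q_i=Ap_i+b$ for all $i$, for some $A\in\mathfrak{so}(3)$, $b\in\mathbb{R}^3$. $P$ is infinitesimally rigid if every isometric infinitesimal deformation of $P$ is trivial. Warped polyhedra: put $\ell_{ij}=\|p_i-p_j\|$ for every edge $p_ip_j$ of $P$. The triangles $0p_ip_j$ over all edges $p_ip_j$ cut $P$ into triangular pyramids with apex $0$ and with the faces of $P$ as bases. For $r$ in a sufficiently small neighborhood $U\subset\mathbb{R}^n$ of $r^0$, replace the pyramid over each face $p_ip_jp_k$ by the Euclidean tetrahedron with lateral edge lengths $r_i,r_j,r_k$ and base edge lengths $\ell_{ij},\ell_{jk},\ell_{ik}$, and glue the new tetrahedra by the old rules; the result is the warped polyhedron $P(r)$. Let $\omega_i(r)$ be the sum of the dihedral angles of these tetrahedra at the lateral edge $0p_i$. The curvature is $\kappa_i(r)=2\pi-\omega_i(r)$;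 $r\mapsto\kappa$ is a $C^\infty$ map $U\to\mathbb{R}^n$. *)

(* Defs.v *)
From mathcomp Require Import all_boot all_order all_algebra.
From mathcomp Require Import all_classical all_reals all_analysis.

Set Implicit Arguments.
Unset Strict Implicit.
Unset Printing Implicit Defensive.

Import Order.TTheory GRing.Theory Num.Theory.
Import numFieldNormedType.Exports.

Local Open Scope classical_set_scope.
Local Open Scope ring_scope.

Section EuclideanGeometry.
Context {R : realType}.

Definition dot (u v : 'cV[R]_3) : R := \sum_k u k 0 * v k 0.

(* Euclidean norm: the library norm on matrices is the sup norm. *)
Definition enorm (u : 'cV[R]_3) : R := Num.sqrt (dot u u).

Definition angle (u v : 'cV[R]_3) : R := acos (dot u v / (enorm u * enorm v)).

Definition orth_part (a b : 'cV[R]_3) : 'cV[R]_3 :=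
  b - (dot a b / dot a a) *: a.

(* Dihedral angle of the tetrahedron [0, a, b, c] at the edge [0, a]. *)
Definition dihedral (a b c : 'cV[R]_3) : R :=
  angle (orth_part a b) (orth_part a c).

End EuclideanGeometry.

Section Polyhedron.
Context {R : realType} {n : nat}.
Implicit Types (p q v : 'I_n -> 'cV[R]_3) (F : {set 'I_n}).

Definition conv_hull p : set 'cV[R]_3 :=
  [set x | exists w : 'I_n -> R,
     [/\ forall i, 0 <= w i, \sum_i w i = 1 & x = \sum_i w i *: p i]].

(* [F] is the set of the indices [i] such that [p i] lies on a face of the
   convex hull of [p]: the set where some linear functional attains an upper
   bound over the [p i]. The improper faces (empty, or everything) are allowed;
   they are told apart from the others by [fdim]. *)
Definition face p F : Prop :=
  exists (u : 'cV[R]_3) (c : R),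
    forall m, dot u (p m) <= c ?= iff (m \in F).

(* Dimension of the affine span of the [p i] with [i] in [F], for nonempty [F]. *)
Definition fdim p F : nat :=
  \rank (\sum_(i in F) \sum_(j in F) <<(p i - p j)^T>>)%MS.

(* As the [p i] will be the vertices of the hull, a 1-dimensional face contains
   exactly two of them. *)
Definition edge p (i j : 'I_n) : Prop := i != j /\ face p [set i; j].

Definition facet p F : Prop := face p F /\ fdim p F = 2%N.

(* The [p i] are the pairwise distinct vertices of their convex hull, and the
   2-dimensional faces of the hull are triangles. That the hull is
   three-dimensional is not required here: it follows once 0 is assumed to be
   interior to it. *)
Definition triangular_polyhedron p : Prop :=
  (forall i, face p [set i]) /\ (forall F, facet p F -> #|F| = 3%N).

Definition isometric_deformation p q : Prop :=
  forall i j, edge p i j -> dot (p i - p j) (q i - q j) = 0.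

Definition trivial_deformation p q : Prop :=
  exists (A : 'M[R]_3) (b : 'cV[R]_3),
    A^T = - A /\ forall i, q i = A *m p i + b.

Definition infinitesimally_rigid p : Prop :=
  forall q, isometric_deformation p q -> trivial_deformation p q.

(* [v] gives the base vertices of a tetrahedron with apex 0 (a pyramid with
   apex 0 when [F] is not a triangle), with lateral edge lengths [r] and with
   the same base edge lengths as the face [F] of [p]. *)
Definition warps p (r : 'rV[R]_n) F v : Prop :=
  (forall i, i \in F -> enorm (v i) = r 0 i) /\
  (forall i j, i \in F -> j \in F -> enorm (v i - v j) = enorm (p i - p j)).

(* A tetrahedron with the prescribed edge lengths, placed arbitrarily in space
   with its apex at 0; an arbitrary value if there is none, which does not
   happen for [F] a triangular facet and [r] near the initial radii. *)
Definition warped_pyramid p r F : 'I_n -> 'cV[R]_3 :=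
  get [set v | warps p r F v].

Definition total_angle p r (i : 'I_n) : R :=
  \sum_(jk : 'I_n * 'I_n |
        (jk.1 < jk.2)%N && `[< facet p [set i; jk.1; jk.2] >])
    let v := warped_pyramid p r [set i; jk.1; jk.2] in
    dihedral (v i) (v jk.1) (v jk.2).

Definition curvature p (i : 'I_n) (r : 'rV[R]_n) : R :=
  2 * pi - total_angle p r i.

Definition radii p : 'rV[R]_n := \row_i enorm (p i).

Definition curvature_jacobian p : 'M[R]_n :=
  \matrix_(i, j) 'D_(delta_mx 0 j) (curvature p i) (radii p).

End Polyhedron.

(* Dimension of the space of the column vectors [x] with [A *m x = 0]
   ([kermx] is the kernel for the action on row vectors). *)
Definition dim_ker {R : fieldType} {m n : nat} (A : 'M[R]_(m, n)) : nat :=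
  \rank (kermx A^T).

(* Main.v *)
Require Import Defs.
From mathcomp Require Import all_boot all_order all_algebra.
From mathcomp Require Import all_classical all_reals all_analysis.
From mathcomp Require Import ring lra zify.

Set Implicit Arguments.
Unset Strict Implicit.
Unset Printing Implicit Defensive.

Import Order.TTheory GRing.Theory Num.Theory.
Import numFieldNormedType.Exports.

Local Open Scope classical_set_scope.
Local Open Scope ring_scope.

(* Write [s i = <p i, q i> / |p i|] for the variation of the radii under a
   deformation [q] of the vertices. It vanishes for all [i] exactly when an
   isometric [q] is a rotation, so it suffices to show that [s] is in the kernel
   of the Jacobian if and only if [s] comes from an isometric deformation.

   The variation of the dihedral angle at [0 p_i] of the pyramid over
   [p_i p_j p_k] is, up to orientation, the difference of the angular velocities
   of its two sides about [p_i]. Around [p_i] these differences cancel in pairs,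
   because every edge lies on two facets, one on each side; hence the angle sums
   are stationary under every deformation of the vertices. For an isometric one
   they are those of the warped pyramids.

   Conversely, let [s] be in the kernel. Facets correspond to vertices of the
   polar dual, and are added in the order of a generic linear functional while
   [q] is built up so that it preserves the edges of the facets already present.
   If two neighbours of the new facet across edges at [p_i] are lower, then so
   are all the other facets at [p_i] by convexity of the polar dual, and the
   stationarity of the angle sum at [p_i] shows that the third edge is preserved
   as well. Otherwise two neighbours across edges at some [p_k] are higher, no
   facet at [p_k] is present yet, and [q k] can be chosen freely. *)

(** * Cross products and determinants in three-space *)

Section VectorAlgebra.
Context {R : realType}.
Implicit Types (a b c u v w x y z : 'cV[R]_3) (k l m : R).

Definition vec k l m : 'cV[R]_3 := \col_i [:: k; l; m]`_i.

Definition cross u v : 'cV[R]_3 :=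
  vec (u 1 0 * v 2%R 0 - u 2%R 0 * v 1 0)
      (u 2%R 0 * v 0 0 - u 0 0 * v 2%R 0)
      (u 0 0 * v 1 0 - u 1 0 * v 0 0).

Definition det3 a b c : R := dot (cross a b) c.

Lemma dotE u v : dot u v = u 0 0 * v 0 0 + u 1 0 * v 1 0 + u 2%R 0 * v 2%R 0.
Proof.
rewrite /dot !big_ord_recr big_ord0 /= add0r.
rewrite (_ : ord_max = 2%R :> 'I_3); last exact: val_inj.
rewrite (_ : widen_ord _ ord_max = 1 :> 'I_3); last exact: val_inj.
by rewrite (_ : widen_ord _ _ = 0 :> 'I_3); last exact: val_inj.
Qed.

Lemma vec3P u v :
  u 0 0 = v 0 0 -> u 1 0 = v 1 0 -> u 2%R 0 = v 2%R 0 -> u = v.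
Proof.
move=> h0 h1 h2; apply/matrixP => i j; rewrite ord1.
have : (i == 0) || (i == 1) || (i == 2%R) by case: i => [[|[|[]]]].
by move=> /orP[/orP[]|] /eqP ->.
Qed.

Lemma vec0E k l m : vec k l m 0 0 = k. Proof. by rewrite mxE. Qed.
Lemma vec1E k l m : vec k l m 1 0 = l. Proof. by rewrite mxE. Qed.
Lemma vec2E k l m : vec k l m 2%R 0 = m. Proof. by rewrite mxE. Qed.

Definition vecE := (vec0E, vec1E, vec2E).

Lemma coordD u v i : (u + v) i 0 = u i 0 + v i 0. Proof. by rewrite mxE. Qed.
Lemma coordB u v i : (u - v) i 0 = u i 0 - v i 0. Proof. by rewrite !mxE. Qed.
Lemma coordN u i : (- u) i 0 = - u i 0. Proof. by rewrite mxE. Qed.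
Lemma coordZ k u i : (k *: u) i 0 = k * u i 0. Proof. by rewrite mxE. Qed.

Definition coordE := (coordB, coordD, coordN, coordZ, vecE).

Lemma dotC u v : dot u v = dot v u.
Proof. by rewrite !dotE; ring. Qed.

Lemma dotDl u v w : dot (u + v) w = dot u w + dot v w.
Proof. by rewrite !dotE !mxE; ring. Qed.

Lemma dotBl u v w : dot (u - v) w = dot u w - dot v w.
Proof. by rewrite !dotE !mxE; ring. Qed.

Lemma dotZl k v w : dot (k *: v) w = k * dot v w.
Proof. by rewrite !dotE !mxE; ring. Qed.

Lemma dotNl v w : dot (- v) w = - dot v w.
Proof. by rewrite !dotE !mxE; ring. Qed.

Lemma dot0l w : dot 0 w = 0.
Proof. by rewrite !dotE !mxE; ring. Qed.

Lemma dotDr u v w : dot w (u + v) = dot w u + dot w v.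
Proof. by rewrite !dotE !mxE; ring. Qed.

Lemma dotBr u v w : dot w (u - v) = dot w u - dot w v.
Proof. by rewrite !dotE !mxE; ring. Qed.

Lemma dotZr k v w : dot w (k *: v) = k * dot w v.
Proof. by rewrite !dotE !mxE; ring. Qed.

Lemma dotNr v w : dot w (- v) = - dot w v.
Proof. by rewrite !dotE !coordE; ring. Qed.

Lemma dot_sumr (I : finType) (f : I -> 'cV[R]_3) w :
  dot w (\sum_i f i) = \sum_i dot w (f i).
Proof.
apply: (big_morph (dot w)); first by move=> u v; rewrite dotDr.
by rewrite dotC dot0l.
Qed.

Definition dot_lin := (dotDl, dotBl, dotZl, dotNl, dotDr, dotBr, dotZr, dotNr).

Lemma dot_ge0 u : 0 <= dot u u.
Proof. by rewrite dotE -!expr2 !addr_ge0 // sqr_ge0. Qed.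

Lemma dot_eq0 u : (dot u u == 0) = (u == 0).
Proof.
apply/eqP/eqP => [|->]; last by rewrite dot0l.
rewrite dotE -!expr2 => /eqP; rewrite !paddr_eq0 ?addr_ge0 ?sqr_ge0 //.
rewrite !sqrf_eq0 => /andP[/andP[/eqP h0 /eqP h1] /eqP h2].
by apply: vec3P; rewrite mxE.
Qed.

Lemma dot_gt0 u : (0 < dot u u) = (u != 0).
Proof. by rewrite lt_def dot_eq0 dot_ge0 andbT. Qed.

Lemma det3C12 a b c : det3 b a c = - det3 a b c.
Proof. by rewrite /det3 !dotE /cross !vecE; ring. Qed.

Lemma det3C23 a b c : det3 a c b = - det3 a b c.
Proof. by rewrite /det3 !dotE /cross !vecE; ring. Qed.

Lemma dot_crossl a b : dot (cross a b) a = 0.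
Proof. by rewrite !dotE /cross !vecE; ring. Qed.

Lemma dot_crossr a b : dot (cross a b) b = 0.
Proof. by rewrite !dotE /cross !vecE; ring. Qed.

(** Cramer's rule in the basis dual to [a], [b], [c]. Scaling by the determinant turns it into a
    polynomial identity, which says something in the degenerate case too. *)
Lemma det3_rep a b c x : det3 a b c *: x =
  dot x a *: cross b c + dot x b *: cross c a + dot x c *: cross a b.
Proof.
by apply: vec3P; rewrite /det3 !dotE /cross !coordE; ring.
Qed.

Lemma det3_rep_dual a b c x : det3 a b c *: x =
  dot x (cross b c) *: a + dot x (cross c a) *: b + dot x (cross a b) *: c.
Proof.
by apply: vec3P; rewrite /det3 !dotE /cross !coordE; ring.
Qed.

Lemma det3_eq0P a b c x : det3 a b c != 0 ->
  dot x a = 0 -> dot x b = 0 -> dot x c = 0 -> x = 0.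
Proof.
move=> D_neq0 xa xb xc; have := det3_rep a b c x.
rewrite xa xb xc !scale0r !addr0 => /eqP.
by rewrite scaler_eq0 (negPf D_neq0) => /eqP.
Qed.

Lemma det3_solve a b c k l m : det3 a b c != 0 ->
  exists x, [/\ dot a x = k, dot b x = l & dot c x = m].
Proof.
move=> D_neq0; exists ((det3 a b c)^-1 *:
  (k *: cross b c + l *: cross c a + m *: cross a b)).
move: D_neq0; rewrite /det3 !dotE /cross !coordE => D_neq0.
by split; field.
Qed.

Lemma exists_orthogonal2 a b :
  exists2 w, w != 0 & dot w a = 0 /\ dot w b = 0.
Proof.
have : kermx (row_mx a b) != 0.
  rewrite -mxrank_eq0 mxrank_ker subn_eq0 -ltnNge.
  exact: leq_ltn_trans (rank_leq_col _) _.
case/rowV0Pn => v /sub_kermxP; rewrite mul_mx_row -row_mx0 => /eq_row_mx[va vb].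
move=> v_neq0; exists v^T; first by rewrite trmx_eq0.
have dot_mul x : dot v^T x = (v *m x) 0 0.
  by rewrite mxE; apply: eq_bigr => i _; rewrite mxE.
by rewrite !dot_mul va vb !mxE.
Qed.

(* [cross a b] and [cross a c] enclose the dihedral angle at the edge [0, a] of
   the tetrahedron [0, a, b, c]. *)
Lemma dot_cross2 a b c :
  dot (cross a b) (cross a c) = dot a a * dot b c - dot a b * dot a c.
Proof. by rewrite !dotE /cross !vecE; ring. Qed.

(** Lagrange's identity, as the cross product of [cross a b] and [cross a c] is
    [det3 a b c *: a]. *)
Lemma gram_det3 a b c : det3 a b c ^+ 2 * dot a a =
  dot (cross a b) (cross a b) * dot (cross a c) (cross a c)
  - dot (cross a b) (cross a c) ^+ 2.
Proof. by rewrite /det3 !dotE /cross !vecE; ring. Qed.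

(** For independent [a] and [b], the vectors [cross a b] and [cross a (cross a b)] form an
    orthogonal basis of the plane orthogonal to [a], in which [cross a c] is expanded here. *)
Lemma cross_reject a b c :
  dot (cross a b) (cross a b) *: cross a c =
  dot (cross a b) (cross a c) *: cross a b
  + det3 a b c *: cross a (cross a b).
Proof. by apply: vec3P; rewrite /det3 !dotE /cross !coordE; ring. Qed.

End VectorAlgebra.

(** * Dihedral angles as functions of the Gram matrix *)

Section DihedralAngleFromGram.
Context {R : realType} {T : Type}.
Implicit Types (G H : T -> T -> R) (i j k : T).

(** For symmetric [G], the minor on the rows [i], [j] and the columns [i], [k]. For a Gram matrix it
    is the scalar product of the cross products of vector [i] with the vectors [j] and [k]. *)
Definition minor G i j k := G i i * G j k - G i j * G i k.

Definition dminor G H i j k :=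
  H i i * G j k + G i i * H j k - (H i j * G i k + G i j * H i k).

Definition gram_angle G i j k : R :=
  acos (minor G i j k / Num.sqrt (minor G i j j * minor G i k k)).

(** The differential of [gram_angle] at [G] in the direction [H], as given by the chain rule; it is
    linear in [H]. *)
Definition dgram_angle G H i j k : R :=
  - (dminor G H i j k - minor G i j k *
     (dminor G H i j j / minor G i j j + dminor G H i k k / minor G i k k) / 2)
  / Num.sqrt (minor G i j j * minor G i k k - minor G i j k ^+ 2).

(** Scalar products of the orthogonal parts are minors divided by [dot (v i) (v i)], a factor that
    cancels in the cosine. *)
Lemma dihedralE (v : T -> 'cV[R]_3) i j k : v i != 0 ->
  dihedral (v i) (v j) (v k) = gram_angle (fun x y => dot (v x) (v y)) i j k.
Proof.
move=> vi_neq0; rewrite /dihedral /angle /gram_angle /enorm.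
have A_gt0 : 0 < dot (v i) (v i) by rewrite dot_gt0.
have A_neq0 := lt0r_neq0 A_gt0.
have orthE x y : dot (orth_part (v i) (v x)) (orth_part (v i) (v y)) =
    minor (fun x y => dot (v x) (v y)) i x y / dot (v i) (v i).
  rewrite /orth_part /minor !dot_lin.
  rewrite (dotC (v x) (v i)).
  by field.
have minor_ge0 x : 0 <= minor (fun x y => dot (v x) (v y)) i x x.
  by rewrite /minor -dot_cross2 dot_ge0.
rewrite -sqrtrM ?dot_ge0 // !orthE mulf_div sqrtrM ?mulr_ge0 //.
rewrite -expr2 -exprVn sqrtr_sqr ger0_norm ?invr_ge0 ?ltW //.
by rewrite invfM invrK mulrACA mulVf // mulr1.
Qed.

Lemma is_derive_minor (G : R -> T -> T -> R) (H : T -> T -> R) i j k :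
  (forall x y, is_derive (0 : R) 1 (fun h => G h x y) (H x y)) ->
  is_derive (0 : R) 1 (fun h => minor (G h) i j k) (dminor (G 0) H i j k).
Proof.
move=> dG; rewrite /minor; apply: is_derive_eq.
by rewrite /GRing.scale /= /dminor; ring.
Qed.

(** The last inequality keeps the cosine strictly between -1 and 1, where [acos] is
    differentiable. *)
Lemma is_derive_gram_angle (G : R -> T -> T -> R) (H : T -> T -> R) i j k :
  (forall x y, is_derive (0 : R) 1 (fun h => G h x y) (H x y)) ->
  0 < minor (G 0) i j j -> 0 < minor (G 0) i k k ->
  0 < minor (G 0) i j j * minor (G 0) i k k - minor (G 0) i j k ^+ 2 ->
  is_derive (0 : R) 1 (fun h => gram_angle (G h) i j k)
    (dgram_angle (G 0) H i j k).
Proof.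
move=> dG Y_gt0 Z_gt0 D_gt0.
have dminorP x y z := is_derive_minor x y z dG.
set X := minor (G 0) i j k; set Y := minor (G 0) i j j.
set Z := minor (G 0) i k k.
have YZ_gt0 : 0 < Y * Z by rewrite mulr_gt0.
have sYZ_gt0 : 0 < Num.sqrt (Y * Z) by rewrite sqrtr_gt0.
pose N := fun h => minor (G h) i j j * minor (G h) i k k.
have dN : is_derive (0 : R) 1 N
    (dminor (G 0) H i j j * Z + Y * dminor (G 0) H i k k).
  by apply: is_derive_eq; rewrite /GRing.scale /= -/Y -/Z; ring.
have dsN : is_derive (0 : R) 1 (fun h => Num.sqrt (N h))
   ((2 * Num.sqrt (Y * Z))^-1 *
    (dminor (G 0) H i j j * Z + Y * dminor (G 0) H i k k)).
  by apply: is_derive1_comp; apply: is_derive1_sqrt.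
have dinv : is_derive (0 : R) 1 (fun h => (Num.sqrt (N h))^-1)
   (- Num.sqrt (Y * Z) ^- 2 *: ((2 * Num.sqrt (Y * Z))^-1 *
    (dminor (G 0) H i j j * Z + Y * dminor (G 0) H i k k))).
  by apply: is_deriveV; rewrite lt0r_neq0.
have sD_gt0 : 0 < Num.sqrt (Y * Z - X ^+ 2) by rewrite sqrtr_gt0.
have sE : Num.sqrt (Y * Z) ^+ 2 = Y * Z by rewrite sqr_sqrtr // ltW.
have sqrt_cos : Num.sqrt (1 - (X / Num.sqrt (Y * Z)) ^+ 2)
    = Num.sqrt (Y * Z - X ^+ 2) / Num.sqrt (Y * Z).
  rewrite expr_div_n sE.
  rewrite (_ : 1 - _ = (Y * Z - X ^+ 2) / (Y * Z)); last first.
    by rewrite (mulrBl (Y * Z)^-1 (Y * Z)) (divff (lt0r_neq0 YZ_gt0)).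
  by rewrite sqrtrM ?ltW // sqrtrV // ltW.
have cos_lt1 : -1 < X / Num.sqrt (Y * Z) < 1.
  rewrite -ltr_norml normrM normfV [X in _ / X]gtr0_norm //.
  rewrite ltr_pdivrMr // mul1r -sqrtr_sqr ltr_sqrt //.
  by rewrite -subr_gt0.
have dcos : is_derive (0 : R) 1
  (fun h => minor (G h) i j k * (Num.sqrt (N h))^-1)
  (X * (- Num.sqrt (Y * Z) ^- 2 * ((2 * Num.sqrt (Y * Z))^-1 *
    (dminor (G 0) H i j j * Z + Y * dminor (G 0) H i k k)))
   + (Num.sqrt (Y * Z))^-1 * dminor (G 0) H i j k).
  exact: is_deriveM.
have := @is_derive1_comp R (@acos R)
  (fun h => minor (G h) i j k * (Num.sqrt (N h))^-1) 0 _ _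
  (is_derive1_acos cos_lt1) dcos.
congr is_derive.
rewrite sqrt_cos /dgram_angle -/X -/Y -/Z invf_div.
have Y_neq0 : Y != 0 by rewrite lt0r_neq0.
have Z_neq0 : Z != 0 by rewrite lt0r_neq0.
have s_neq0 := lt0r_neq0 sYZ_gt0; have d_neq0 := lt0r_neq0 sD_gt0.
move: (dminor _ _ _ _ _) (dminor _ _ _ _ _) (dminor _ _ _ _ _) => dY dZ dX.
move: sE s_neq0 d_neq0; set s := Num.sqrt (Y * Z); set d := Num.sqrt (_ - _).
move=> sE s_neq0 d_neq0.
(* Eliminating [Z] by the square of the root [s] leaves a purely rational identity. *)
have -> : Z = s ^+ 2 / Y by rewrite sE; field.
by field; rewrite s_neq0 Y_neq0 d_neq0.
Qed.

End DihedralAngleFromGram.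

(** * Variation of a dihedral angle under a motion *)

Section AngleVariation.
Context {R : realType} {T : finType}.
Implicit Types (G H : T -> T -> R) (v q : T -> 'cV[R]_3) (i j k : T).

Definition gram_of v (x y : T) : R := dot (v x) (v y).

Definition dgram_of v q (x y : T) : R := dot (q x) (v y) + dot (v x) (q y).

Definition dcross v q i j := cross (q i) (v j) + cross (v i) (q j).

(* Angular velocity about [v i], relative to the parallel transport along the
   motion [q i] of the axis, of the half-plane through [v i] and [v j]. *)
Definition spin v q i j : R :=
  dot (dcross v q i j) (cross (v i) (cross (v i) (v j))) /
  (Num.sqrt (dot (v i) (v i)) * dot (cross (v i) (v j)) (cross (v i) (v j))).

Lemma minor_gram_of v i j k :
  minor (gram_of v) i j k = dot (cross (v i) (v j)) (cross (v i) (v k)).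
Proof. by rewrite dot_cross2. Qed.

Lemma dminor_gram_of v q i j k : dminor (gram_of v) (dgram_of v q) i j k =
  dot (dcross v q i j) (cross (v i) (v k)) +
  dot (dcross v q i k) (cross (v i) (v j)).
Proof.
rewrite /dminor /gram_of /dgram_of /dcross !dotE /cross !coordE; ring.
Qed.

Lemma det3_cross_neq0 (a b c : 'cV[R]_3) : det3 a b c != 0 ->
  0 < dot (cross a b) (cross a b).
Proof.
rewrite dot_gt0; apply: contra_neq; rewrite /det3 => ->.
by rewrite dot0l.
Qed.

Lemma det3_neq0 (a b c : 'cV[R]_3) : det3 a b c != 0 -> a != 0.
Proof.
apply: contra_neq => ->; rewrite /det3.
by rewrite dotE /cross !coordE !mxE; ring.
Qed.

Lemma dot_cross_reject (a b c w : 'cV[R]_3) : det3 a b c != 0 ->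
  det3 a b c * (dot w (cross a (cross a b)) / dot (cross a b) (cross a b)) =
  dot w (cross a c) - dot (cross a b) (cross a c) *
    (dot w (cross a b) / dot (cross a b) (cross a b)).
Proof.
move=> D_neq0; have Y_neq0 := lt0r_neq0 (det3_cross_neq0 D_neq0).
have := congr1 (dot w) (cross_reject a b c).
rewrite dotDr !dotZr => E.
apply: (mulfI Y_neq0); rewrite mulrBr E; field.
by rewrite Y_neq0.
Qed.

(** Each [dcross] is split by [dot_cross_reject]. The components along the cross products only
    change their lengths and cancel against the normalisation of the cosine; the perpendicular ones
    are the spins. The sign enters because [acos] measures the unsigned angle. *)
Lemma dgram_angle_motion v q i j k : det3 (v i) (v j) (v k) != 0 ->
  dgram_angle (gram_of v) (dgram_of v q) i j k =
  Num.sg (det3 (v i) (v j) (v k)) * (spin v q i k - spin v q i j).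
Proof.
move=> D_neq0; rewrite /dgram_angle /spin !minor_gram_of -gram_det3.
have D'_neq0 : det3 (v i) (v k) (v j) != 0 by rewrite det3C23 oppr_eq0.
have Y_gt0 := det3_cross_neq0 D_neq0.
have Z_gt0 := det3_cross_neq0 D'_neq0.
have A_gt0 : 0 < dot (v i) (v i) by rewrite dot_gt0 (det3_neq0 D_neq0).
have sA_gt0 : 0 < Num.sqrt (dot (v i) (v i)) by rewrite sqrtr_gt0.
have E1 := dot_cross_reject (dcross v q i j) D_neq0.
have E2 := dot_cross_reject (dcross v q i k) D'_neq0.
rewrite det3C23 (dotC (cross (v i) (v k)) (cross (v i) (v j))) in E2.
rewrite sqrtrM ?sqr_ge0 // sqrtr_sqr !dminor_gram_of.
have nD_neq0 : `|det3 (v i) (v j) (v k)| != 0 by rewrite normr_eq0.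
have Y_neq0 := lt0r_neq0 Y_gt0; have Z_neq0 := lt0r_neq0 Z_gt0.
have sA_neq0 := lt0r_neq0 sA_gt0.
have DE := numEsg (det3 (v i) (v j) (v k)).
have sg2 :
    Num.sg (det3 (v i) (v j) (v k)) * Num.sg (det3 (v i) (v j) (v k)) = 1.
  by rewrite -expr2 sqr_sg D_neq0.
move: E1 E2 Y_neq0 Z_neq0 sA_neq0 nD_neq0 DE sg2.
set Y := dot (cross (v i) (v j)) (cross (v i) (v j)).
set Z := dot (cross (v i) (v k)) (cross (v i) (v k)).
set X := dot (cross (v i) (v j)) (cross (v i) (v k)).
set sA := Num.sqrt _.
set D := det3 _ _ _; set e := Num.sg D.
set xj := dot (dcross v q i j) (cross (v i) (v k)).
set xk := dot (dcross v q i k) (cross (v i) (v j)).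
set yj := dot _ (cross (v i) (v j)).
set zk := dot (dcross v q i k) (cross (v i) (v k)).
set uj := dot (dcross v q i j) (cross (v i) (cross (v i) (v j))).
set uk := dot _ (cross (v i) (cross (v i) (v k))).
move: `|D| => nD E1 E2 Y_neq0 Z_neq0 sA_neq0 nD_neq0 DE sg2.
clearbody e D X Y Z sA xj xk yj zk uj uk.
have -> : uk / (sA * Z) - uj / (sA * Y) = (uk / Z - uj / Y) / sA.
  by field; rewrite sA_neq0 Y_neq0.
have -> : xj = D * (uj / Y) + X * (yj / Y) by rewrite E1 subrK.
have -> : xk = - D * (uk / Z) + X * (zk / Z) by rewrite E2 subrK.
rewrite DE.
by field; rewrite sA_neq0 Y_neq0 Z_neq0 nD_neq0.
Qed.

(** Linearity in the direction, by which partial derivatives in the single radii combine into the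
    derivative along a vector of rates. *)
Lemma dgram_angle_sum (I : finType) (s : I -> R) (F : I -> T -> T -> R)
    G i j k :
  dgram_angle G (fun x y => \sum_m s m * F m x y) i j k =
  \sum_m s m * dgram_angle G (F m) i j k.
Proof.
pose d := Num.sqrt (minor G i j j * minor G i k k - minor G i j k ^+ 2).
pose X := minor G i j k; pose Y := minor G i j j; pose Z := minor G i k k.
have dminorE (H : T -> T -> R) x y z : dminor G H x y z =
  G y z * H x x + G x x * H y z - G x z * H x y - G x y * H x z.
  by rewrite /dminor; ring.
have dangleE (H : T -> T -> R) : dgram_angle G H i j k =
    (- d^-1) * dminor G H i j k + (X / d / Y / 2) * dminor G H i j j +
    (X / d / Z / 2) * dminor G H i k k.
  by rewrite /dgram_angle -/X -/Y -/Z -/d; ring.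
have dminor_sum x y z : dminor G (fun x y => \sum_m s m * F m x y) x y z =
    \sum_m s m * dminor G (F m) x y z.
  rewrite dminorE !mulr_sumr -big_split -sumrB -sumrB.
  by apply: eq_bigr => m _ /=; rewrite dminorE; ring.
rewrite dangleE !dminor_sum !mulr_sumr -!big_split /=.
by apply: eq_bigr => m _ /=; rewrite dangleE; ring.
Qed.

(** When the other four entries are fixed, [H j k] enters only through [dminor G H i j k], with the
    nonzero coefficient [G i i]: the dihedral angle controls the opposite edge. *)
Lemma dgram_angle_inj G H H' i j k : G i i != 0 ->
  0 < minor G i j j * minor G i k k - minor G i j k ^+ 2 ->
  H i i = H' i i -> H i j = H' i j -> H i k = H' i k ->
  H j j = H' j j -> H k k = H' k k ->
  dgram_angle G H i j k = dgram_angle G H' i j k -> H j k = H' j k.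
Proof.
move=> A_neq0 D_gt0 Hii Hij Hik Hjj Hkk.
rewrite /dgram_angle => /mulIf E.
have {}E := E (invr_neq0 (lt0r_neq0 _)); move: E.
rewrite sqrtr_gt0 => /(_ D_gt0) /oppr_inj.
rewrite /dminor Hii Hij Hik Hjj Hkk => /addIr /addIr /addrI.
exact: mulfI.
Qed.

End AngleVariation.

(** * Derivatives along a line *)

Section RealLine.
Context {R : realType}.

Lemma is_derive_bigsum (I : Type) (s : seq I) (P : pred I) (f : I -> R -> R)
    (df : I -> R) (x : R) :
  (forall k, P k -> is_derive x 1 (f k) (df k)) ->
  is_derive x 1 (fun h => \sum_(k <- s | P k) f k h) (\sum_(k <- s | P k) df k).
Proof.
move=> Pdf; elim: s => [|k s IH].
  rewrite big_nil; under eq_fun do rewrite big_nil.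
  exact: is_derive_cst.
rewrite big_cons; under eq_fun do rewrite big_cons.
case: ifPn => // Pk.
by have ? := Pdf _ Pk; exact: is_deriveD.
Qed.

Lemma is_derive_near_gt0 (f : R -> R) (x d : R) :
  is_derive x 1 f d -> 0 < f x -> \forall h \near x, 0 < f h.
Proof.
move=> [df _] fx_gt0.
have cf : {for x, continuous f}.
  exact/differentiable_continuous/derivable1_diffP.
exact: (@cvgr_gt R R (nbhs x) _ f (f x) cf 0 fx_gt0).
Qed.

Lemma derive_line (V : normedModType R) (f : V -> R) (a v : V) :
  'D_v f a = 'D_1 (fun h : R => f (h *: v + a)) 0.
Proof.
rewrite /derive; set g := (g in lim (g @ _)); set g' := (g in _ = lim (g @ _)).
suff -> : g = g' by [].
apply/funext => h; rewrite /g /g' /=.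
rewrite /shift /= addr0 scale0r add0r.
by rewrite [h *: 1]mulr1.
Qed.

End RealLine.

(** * Warped pyramids and the derivative of the curvature *)

Section WarpedPyramid.
Context {R : realType} {n : nat}.
Implicit Types (p v : 'I_n -> 'cV[R]_3) (r : 'rV[R]_n) (i j k : 'I_n).

(** The law of cosines for the triangle with lateral sides [r 0 i] and [r 0 j] and the original base
    length. *)
Definition warped_gram p r i j : R :=
  (r 0 i ^+ 2 + r 0 j ^+ 2 - dot (p i - p j) (p i - p j)) / 2.

Lemma dot_sub (a b : 'cV[R]_3) :
  dot (a - b) (a - b) = dot a a + dot b b - 2 * dot a b.
Proof. by rewrite !dot_lin (dotC b a); ring. Qed.

Lemma sqr_enorm (a : 'cV[R]_3) : enorm a ^+ 2 = dot a a.
Proof. by rewrite sqr_sqrtr // dot_ge0. Qed.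

Lemma enorm_dot (a b : 'cV[R]_3) : (enorm a = enorm b) <-> (dot a a = dot b b).
Proof.
by split=> [E|E]; [rewrite -!sqr_enorm E|rewrite /enorm E].
Qed.

Lemma warps_gram p r F v i j : warps p r F v -> i \in F -> j \in F ->
  dot (v i) (v j) = warped_gram p r i j.
Proof.
case=> vr vl iF jF; rewrite /warped_gram -!vr // !sqr_enorm.
have := vl _ _ iF jF; rewrite enorm_dot => <-.
by rewrite dot_sub; field.
Qed.

Lemma warped_gram_radii p : warped_gram p (radii p) = gram_of p.
Proof.
apply/funext => i; apply/funext => j.
rewrite /warped_gram /gram_of !mxE !sqr_enorm dot_sub.
by field.
Qed.

(* The three vectors are the rows of the Cholesky factor of [G]. *)
Lemma gram_realizable (G : 'I_n -> 'I_n -> R) i j k :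
  0 < G i i -> 0 < minor G i j j ->
  0 < minor G i j j * minor G i k k - minor G i j k ^+ 2 ->
  exists a b c : 'cV[R]_3,
    [/\ dot a a = G i i, dot b b = G j j & dot c c = G k k] /\
    [/\ dot a b = G i j, dot a c = G i k & dot b c = G j k].
Proof.
move=> A_gt0 Y_gt0 D_gt0.
pose sA := Num.sqrt (G i i); pose sY := Num.sqrt (minor G i j j).
pose sD := Num.sqrt (minor G i j j * minor G i k k - minor G i j k ^+ 2).
have sA2 : sA ^+ 2 = G i i by rewrite sqr_sqrtr ?ltW.
have sY2 : sY ^+ 2 = G i i * G j j - G i j ^+ 2.
  by rewrite sqr_sqrtr ?ltW.
have sD2 : sD ^+ 2 = (G i i * G j j - G i j ^+ 2) * (G i i * G k k - G i k ^+ 2)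
  - (G i i * G j k - G i j * G i k) ^+ 2.
  by rewrite sqr_sqrtr ?ltW.
have sA0 : sA != 0 by rewrite lt0r_neq0 ?sqrtr_gt0.
have sY0 : sY != 0 by rewrite lt0r_neq0 ?sqrtr_gt0.
have A0 := lt0r_neq0 A_gt0; have Y0 : G i i * G j j - G i j ^+ 2 != 0.
  by rewrite -sY2 expf_neq0.
exists (vec sA 0 0), (vec (G i j / sA) (sY / sA) 0),
  (vec (G i k / sA) (minor G i j k / (sA * sY)) (sD / (sA * sY))).
rewrite !dotE !vecE -!expr2 !(expr_div_n, exprMn) sA2 sY2 sD2 /minor.
clearbody sA sY sD.
split; split;
  [ring|by field|by field; rewrite Y0 A0|by field|by field; rewrite sY0|].
by rewrite -sA2; field; rewrite sY0.
Qed.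

(** The inequalities provide a tetrahedron with these edge lengths, so that the choice made by
    [warped_pyramid] does satisfy [warps]. The angle is independent of the choice, because the edge
    lengths determine the Gram matrix. *)
Lemma dihedral_warped_pyramid p r i j k :
  i != j -> i != k -> j != k -> 0 < r 0 i -> 0 < r 0 j -> 0 < r 0 k ->
  let G := warped_gram p r in
  0 < minor G i j j ->
  0 < minor G i j j * minor G i k k - minor G i j k ^+ 2 ->
  let v := warped_pyramid p r [set i; j; k] in
  dihedral (v i) (v j) (v k) = gram_angle G i j k.
Proof.
move=> ij ik jk ri rj rk G Y_gt0 D_gt0 v.
have symG x y : G x y = G y x.
  by rewrite /G /warped_gram !dot_sub (dotC (p x)); ring.
have GE x : G x x = r 0 x ^+ 2.
  by rewrite /G /warped_gram subrr dot0l; field.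
have [] := @gram_realizable G i j k => //; first by rewrite GE exprn_gt0.
move=> a [b [c [[aa bb cc] [ab ac bc]]]].
have v_warps : warps p r [set i; j; k] v.
  apply: (@getPex _ [set v | warps p r [set i; j; k] v]).
  pose w m := if m == i then a else if m == j then b else c.
  have wi : w i = a by rewrite /w eqxx.
  have wj : w j = b by rewrite /w eq_sym (negPf ij) eqxx.
  have wk : w k = c by rewrite /w eq_sym (negPf ik) eq_sym (negPf jk).
  have in3 x : x \in [set i; j; k]%SET -> [\/ x = i, x = j | x = k].
    by rewrite !inE => /orP[/orP[]|] /eqP ->;
      [apply: Or31|apply: Or32|apply: Or33].
  have wG x y : x \in [set i; j; k]%SET -> y \in [set i; j; k]%SET ->
      dot (w x) (w y) = G x y.
    by move=> /in3[]-> /in3[]->; rewrite ?(wi, wj, wk) // dotC symG.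
  have r_gt0 x : x \in [set i; j; k]%SET -> 0 < r 0 x by move/in3 => []->.
  exists w; split=> [x xF|x y xF yF].
    by rewrite /enorm wG // GE sqrtr_sqr gtr0_norm // r_gt0.
  rewrite enorm_dot dot_sub !wG // !GE /G /warped_gram.
  by field.
have vG x y : x \in [set i; j; k]%SET -> y \in [set i; j; k]%SET ->
  dot (v x) (v y) = G x y by exact: warps_gram.
have [iF jF kF] : [/\ i \in [set i; j; k]%SET, j \in [set i; j; k]%SET &
   k \in [set i; j; k]%SET] by rewrite !inE !eqxx !orbT.
rewrite dihedralE; first by rewrite /gram_angle /minor !vG.
by rewrite -dot_gt0 vG // GE exprn_gt0.
Qed.

Lemma det3_distinct p i j k : det3 (p i) (p j) (p k) != 0 ->
  [/\ i != j, i != k & j != k].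
Proof.
move=> D_neq0; split; apply: contra_neq D_neq0 => ->.
- by rewrite /det3 !dotE /cross !coordE; ring.
- by rewrite /det3 dot_crossl.
- by rewrite /det3 dot_crossr.
Qed.

(** The differential of [warped_gram p] at [radii p] in the direction [s]: the base lengths are
    constant, and only the squares of the two radii vary. *)
Definition dwarped_gram p (s : 'I_n -> R) i j : R :=
  enorm (p i) * s i + enorm (p j) * s j.

Lemma is_derive_warped_gram p m i j :
  is_derive (0 : R) 1
    (fun h => warped_gram p (h *: delta_mx 0 m + radii p) i j)
    (dwarped_gram p (fun x => (x == m)%:R) i j).
Proof.
rewrite /warped_gram; under eq_fun do rewrite !mxE eqxx /=.
apply: is_derive_eq; rewrite /GRing.scale /= /dwarped_gram.
by field.
Qed.

Lemma is_derive_dihedral p m i j k :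
  i != j -> i != k -> j != k -> det3 (p i) (p j) (p k) != 0 ->
  is_derive (0 : R) 1
    (fun h => let v := warped_pyramid p (h *: delta_mx 0 m + radii p)
                [set i; j; k] in dihedral (v i) (v j) (v k))
    (dgram_angle (gram_of p) (dwarped_gram p (fun x => (x == m)%:R)) i j k).
Proof.
move=> ij ik jk D_neq0.
pose G h := warped_gram p (h *: delta_mx 0 m + radii p).
have G0 : G 0 = gram_of p by rewrite /G scale0r add0r warped_gram_radii.
have D'_neq0 : det3 (p i) (p k) (p j) != 0 by rewrite det3C23 oppr_eq0.
have dG x y : is_derive (0 : R) 1 (fun h => G h x y) _ :=
  is_derive_warped_gram p m x y.
have Y_gt0 : 0 < minor (G 0) i j j.
  by rewrite G0 minor_gram_of (det3_cross_neq0 D_neq0).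
have Z_gt0 : 0 < minor (G 0) i k k.
  by rewrite G0 minor_gram_of (det3_cross_neq0 D'_neq0).
have D_gt0 : 0 < minor (G 0) i j j * minor (G 0) i k k - minor (G 0) i j k ^+ 2.
  rewrite G0 !minor_gram_of -gram_det3 mulr_gt0 ?exprn_even_gt0 //.
  by rewrite dot_gt0 (det3_neq0 D_neq0).
rewrite -G0.
(* The Gram formula for the angle is available only where the tetrahedron exists; the positivity
   conditions for this hold at 0, hence nearby by continuity. *)
apply: near_eq_is_derive (is_derive_gram_angle dG Y_gt0 Z_gt0 D_gt0).
have dr x : is_derive (0 : R) 1
    (fun h => (h *: delta_mx 0 m + radii p) 0 x) (x == m)%:R.
  under eq_fun do rewrite !mxE eqxx /=.
  by apply: is_derive_eq; rewrite /GRing.scale /=; ring.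
have rE x : (radii p : 'rV[R]_n) 0 x = (0 *: delta_mx 0 m + radii p) 0 x.
  by rewrite scale0r add0r.
have r_gt0 x : p x != 0 -> 0 < (0 *: delta_mx 0 m + radii p) 0 x.
  by move=> px; rewrite -rE mxE sqrtr_gt0 dot_gt0.
have D2_neq0 : det3 (p j) (p i) (p k) != 0 by rewrite det3C12 oppr_eq0.
have D3_neq0 : det3 (p k) (p i) (p j) != 0.
  by rewrite det3C12 oppr_eq0.
have pos_i := is_derive_near_gt0 (dr i) (r_gt0 _ (det3_neq0 D_neq0)).
have pos_j := is_derive_near_gt0 (dr j) (r_gt0 _ (det3_neq0 D2_neq0)).
have pos_k := is_derive_near_gt0 (dr k) (r_gt0 _ (det3_neq0 D3_neq0)).
have dY := is_derive_minor i j j dG.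
have dZ := is_derive_minor i k k dG.
have dX := is_derive_minor i j k dG.
have dD := is_deriveB (is_deriveM dY dZ) (is_deriveM dX dX).
have pos_Y := is_derive_near_gt0 dY Y_gt0.
have pos_D := is_derive_near_gt0 dD D_gt0.
near=> h; apply/esym/dihedral_warped_pyramid => //; near: h; [exact: pos_i|
  exact: pos_j|exact: pos_k|exact: pos_Y|exact: pos_D].
Unshelve. all: by end_near. Qed.

Lemma derive_curvature p i m :
  (forall j k, facet p [set i; j; k] -> det3 (p i) (p j) (p k) != 0) ->
  'D_(delta_mx 0 m) (curvature p i) (radii p) =
  - \sum_(jk : 'I_n * 'I_n |
        (jk.1 < jk.2)%N && `[< facet p [set i; jk.1; jk.2] >])
    dgram_angle (gram_of p) (dwarped_gram p (fun x => (x == m)%:R)) i jk.1 jk.2.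
Proof.
move=> nondeg; rewrite derive_line -[RHS]add0r.
apply: derive_val; rewrite /curvature /total_angle.
apply: is_deriveB.
apply: is_derive_bigsum => -[j k] /= /andP[jk /asboolP /nondeg D_neq0].
have [ij ik jk'] := det3_distinct D_neq0.
exact: is_derive_dihedral.
Qed.

End WarpedPyramid.

(** * Supporting planes of the convex hull *)

Section Hull.
Context {R : realType} {n : nat} (p : 'I_n -> 'cV[R]_3).
Implicit Types (u w : 'cV[R]_3) (F G : {set 'I_n}) (i j k l m : 'I_n).

(* The facets do not contain the origin, so that their supporting planes are
   normalised to [dot u x = 1]: [u] is a vertex of the polar dual. *)
Definition supports u F : Prop := forall m, dot u (p m) <= 1 ?= iff (m \in F).

Definition contact u : {set 'I_n} := [set m | dot u (p m) == 1]%SET.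

Lemma supports_contact u :
  (forall m, dot u (p m) <= 1) -> supports u (contact u).
Proof. by move=> u_le1 m; split; rewrite ?u_le1 // inE. Qed.

Lemma supports1 u F m : supports u F -> m \in F -> dot u (p m) = 1.
Proof. by move=> uF mF; apply/eqP; rewrite (uF m).2. Qed.

Lemma supports_inj u F G : supports u F -> supports u G -> F = G.
Proof. by move=> uF uG; apply/setP => m; rewrite -(uF m).2 (uG m).2. Qed.

Lemma supports_face u F : supports u F -> face p F.
Proof. by move=> uF; exists u, 1. Qed.

(** A mean of two numbers at most 1 equals 1 only if both do. In this way the common edge of two
    facets is recognised as a face. *)
Lemma supports_mean u v F G : supports u F -> supports v G ->
  supports (2^-1 *: (u + v)) (F :&: G).
Proof.
move=> uF vG m; rewrite inE dotZl dotDl.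
have [u1 <-] := uF m; have [v1 <-] := vG m; split; first by lra.
by apply/eqP/andP => [E|[/eqP -> /eqP ->]]; [split; apply/eqP; lra|lra].
Qed.

(** The supporting plane is tilted in the direction [w] until it meets a vertex on the side where
    [w] is positive; [t] is the least of the values at which such a vertex is met. *)
Lemma tilt u w : (forall m, dot u (p m) <= 1) -> (exists m, 0 < dot w (p m)) ->
  exists t, (forall m, dot (u + t *: w) (p m) <= 1) /\
    exists2 m, 0 < dot w (p m) & dot (u + t *: w) (p m) = 1.
Proof.
move=> u_le1 [m0 m0_gt0].
case: (@arg_minP _ _ _ m0 (fun m => 0 < dot w (p m))
  (fun m => (1 - dot u (p m)) / dot w (p m)) m0_gt0) => m m_gt0 m_min.
set t := _ / _ in m_min; exists t; split; last first.
  by exists m => //; rewrite dotDl dotZl /t divfK ?lt0r_neq0 // subrKC.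
move=> k; rewrite dotDl dotZl -lerBrDl.
have [k_gt0|k_le0] := ltP 0 (dot w (p k)).
  by rewrite -ler_pdivlMr // m_min.
have t_ge0 : 0 <= t by rewrite divr_ge0 ?subr_ge0 // ltW.
by rewrite (le_trans (mulr_ge0_le0 t_ge0 k_le0)) // subr_ge0.
Qed.

Context (p_int : (conv_hull p)° 0).

(** The hull contains some [h *: w] with [h > 0]. A convex combination of vertices at which [w] is
    nonpositive could not reach it. *)
Lemma hull_direction w : w != 0 -> exists m, 0 < dot w (p m).
Proof.
move=> w_neq0.
have near_hull : \forall h \near (0 : R), conv_hull p (h *: w).
  by apply: scalel_continuous; rewrite scale0r.
have [h [h_gt0 [c [c_ge0 _ hE]]]] :
    exists h : R, 0 < h /\ conv_hull p (h *: w).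
  near (0 : R)^'+ => h; exists h; split=> //; near: h.
  exact: cvg_within near_hull.
apply/not_existsP => w_le0.
have : 0 < dot w (h *: w) by rewrite dotZr mulr_gt0 // dot_gt0.
rewrite hE dot_sumr ltNge => /negP; apply; apply: sumr_le0 => m _.
by rewrite dotZr mulr_ge0_le0 // leNgt; apply/negP/w_le0.
Unshelve. all: by end_near. Qed.

(** Otherwise a normal [w] of a plane through the three points would be constant on all vertices,
    although both [w] and [- w] are positive somewhere. *)
Lemma exists_other_vertex i j k : exists m, m \notin [set i; j; k]%SET.
Proof.
have [w w_neq0 [wij wik]] := exists_orthogonal2 (p i - p j) (p i - p k).
have [m m_gt0] := hull_direction w_neq0.
have [|m' m'_gt0] := @hull_direction (- w); first by rewrite oppr_eq0.
apply/not_existsP => all_in.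
have const x : dot w (p x) = dot w (p i).
  have := all_in x; move/negP; rewrite negbK !inE.
  rewrite !dotBr in wij wik.
  by move=> /orP[/orP[]|] /eqP ->; [|apply/eqP; rewrite eq_sym -subr_eq0 wij|
   apply/eqP; rewrite eq_sym -subr_eq0 wik].
by move: m_gt0 m'_gt0; rewrite dotNl !const; lra.
Qed.

(** The functional of a nonempty proper face is nonzero, hence positive at some vertex; its bound
    [c] is then positive and can be scaled to 1. *)
Lemma face_supports F : face p F -> (exists m, m \in F) ->
  (exists m, m \notin F) -> exists u, supports u F.
Proof.
move=> [u [c uF]] [m mF] [m' m'F].
have u_neq0 : u != 0.
  apply: contraNneq m'F => u0; rewrite -(uF m').2.
  by have := (uF m).2; rewrite mF u0 !dot0l.
have [k k_gt0] := hull_direction u_neq0.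
have c_gt0 : 0 < c := lt_le_trans k_gt0 (uF k).1.
exists (c^-1 *: u) => x; have [ux <-] := uF x.
rewrite dotZl mulrC; split; first by rewrite ler_pdivrMr // mul1r.
rewrite -[X in _ == X](@divff _ c) ?lt0r_neq0 // (inj_eq (mulIf _)) //.
by rewrite invr_eq0 lt0r_neq0.
Qed.

End Hull.

(** * Dimension of faces *)

Section Facets.
Context {R : realType} {n : nat} (p : 'I_n -> 'cV[R]_3).
Implicit Types (u w : 'cV[R]_3) (F G : {set 'I_n}) (i j k l m : 'I_n).

Lemma cross_eq0_collinear (a b : 'cV[R]_3) : a != 0 -> cross a b = 0 ->
  b = (dot a b / dot a a) *: a.
Proof.
move=> a_neq0 ab0; have A_neq0 : dot a a != 0 by rewrite dot_eq0.
have E : dot a a *: b = dot a b *: a + cross (cross a b) a.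
  by apply: vec3P; rewrite !dotE /cross !coordE; ring.
apply: (scalerI A_neq0); rewrite E ab0 scalerA mulrCA divff // mulr1.
by rewrite [cross 0 a](_ : _ = 0) ?addr0 //; apply: vec3P;
  rewrite /cross !coordE !mxE; ring.
Qed.

Lemma supports_cross_eq0 u F i j : supports p u F -> i \in F -> j \in F ->
  cross (p i) (p j) = 0 -> p i = p j.
Proof.
move=> uF iF jF ij0; have ui := supports1 uF iF; have uj := supports1 uF jF.
have pi_neq0 : p i != 0.
  by apply: contra_eq_neq ui => ->; rewrite dotC dot0l eq_sym oner_neq0.
have E := cross_eq0_collinear pi_neq0 ij0.
by move: uj; rewrite E dotZr ui mulr1 => ->; rewrite scale1r.
Qed.

Lemma fdim_collinear i j k : cross (p j - p i) (p k - p i) = 0 ->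
  p j != p i -> (fdim p [set i; j; k] <= 1)%N.
Proof.
move=> cr ji; have d_neq0 : p j - p i != 0 by rewrite subr_eq0.
have kE := cross_eq0_collinear d_neq0 cr.
apply: leq_trans (rank_leq_row (p j - p i)^T); apply: mxrankS.
have on_line x : x \in [set i; j; k]%SET ->
    exists c, p x = p i + c *: (p j - p i).
  rewrite !inE => /orP[/orP[]|] /eqP ->.
  - by exists 0; rewrite scale0r addr0.
  - by exists 1; rewrite scale1r subrKC.
  - exists (dot (p j - p i) (p k - p i) / dot (p j - p i) (p j - p i)).
    by rewrite -kE subrKC.
apply/sumsmx_subP => x xF; apply/sumsmx_subP => y yF; rewrite genmxE.
have [[c ->] [c' ->]] := (on_line x xF, on_line y yF).
rewrite opprD addrACA subrr add0r -scalerBl linearZ /=.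
by rewrite scalemx_sub.
Qed.

(** The differences of vertices in [F] are orthogonal to [u], which bounds the rank by 2.
    Conversely, adding [p i] to their span yields [p i], [p j] and [p k], hence the whole space. *)
Lemma fdim_supports u F i j k : supports p u F ->
  i \in F -> j \in F -> k \in F -> det3 (p i) (p j) (p k) != 0 ->
  fdim p F = 2%N.
Proof.
move=> uF iF jF kF D_neq0; apply/eqP; rewrite eqn_leq; apply/andP; split.
  have u_neq0 : u != 0.
    apply: contra_eq_neq (supports1 uF iF) => ->.
    by rewrite dot0l eq_sym oner_neq0.
  have -> : 2%N = \rank (kermx u).
    by rewrite mxrank_ker -mxrank_tr rank_rV trmx_eq0 u_neq0.
  apply: mxrankS.
  apply/sumsmx_subP => x xF; apply/sumsmx_subP => y yF; rewrite genmxE.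
  apply/sub_kermxP/matrixP => a b; rewrite !ord1 mxE [RHS]mxE.
  have : dot (p x - p y) u = 0.
    by rewrite dotC dotBr (supports1 uF xF) (supports1 uF yF) subrr.
  by move=> E; apply: etrans E; apply: eq_bigr => c _; rewrite mxE.
pose M := (\sum_(x in F) \sum_(y in F) <<(p x - p y)^T>>)%MS.
rewrite -[fdim p F]/(\rank M) -(leq_add2r 1) -[(2 + 1)%N](mxrank1 R).
apply: leq_trans (_ : \rank (M + <<(p i)^T>>)%MS <= _)%N; last first.
  apply: leq_trans (mxrank_adds_leqif _ _).1 _.
  by rewrite leq_add2l mxrank_gen rank_leq_row.
apply: mxrankS; apply/row_subP => a.
set S := (M + _)%MS.
have iS : ((p i)^T <= S)%MS by rewrite (submx_trans _ (addsmxSr _ _)) // genmxE.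
have FS x : x \in F -> ((p x)^T <= S)%MS.
  move=> xF; rewrite -[p x](subrK (p i)) linearD addmx_sub //.
  apply: submx_trans (addsmxSl _ _).
  rewrite -genmxE /M (sumsmx_sup x) // (sumsmx_sup i) //.
rewrite -[row _ _]trmxK.
have -> : (row a 1%:M : 'rV[R]_3)^T =
    (det3 (p i) (p j) (p k))^-1 *: (det3 (p i) (p j) (p k) *: (row a 1%:M)^T).
  by rewrite scalerA mulVf // scale1r.
rewrite det3_rep_dual linearZ !linearD /= !linearZ /=.
by rewrite scalemx_sub // !addmx_sub // scalemx_sub // FS.
Qed.

(** * Incidence of facets, edges and vertices *)

Section Polyhedron.
Context (p_poly : triangular_polyhedron p) (p_int : (conv_hull p)° 0).

Lemma vertex_inj i j : p i = p j -> i = j.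
Proof.
move=> ij; have [u [c uF]] := p_poly.1 i.
have := (uF i).2; rewrite inE eqxx ij (uF j).2 inE => /eqP.
by [].
Qed.

Lemma card3E F i j k : #|F| = 3%N -> i \in F -> j \in F -> k \in F ->
  i != j -> i != k -> j != k -> F = [set i; j; k]%SET.
Proof.
move=> F3 iF jF kF ij ik jk; apply/esym/eqP; rewrite eqEcard F3; apply/andP.
split.
  by apply/fintype.subsetP => x; rewrite !inE => /orP[/orP[]|] /eqP ->.
by rewrite finset.setUC cardsU1 cards2 !inE negb_or ij eq_sym ik eq_sym jk.
Qed.

Lemma supports_facet u F i j k : supports p u F ->
  i \in F -> j \in F -> k \in F -> det3 (p i) (p j) (p k) != 0 ->
  facet p [set i; j; k] /\ F = [set i; j; k]%SET.
Proof.
move=> uF iF jF kF D_neq0; have [ij ik jk] := det3_distinct D_neq0.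
have facetF : facet p F.
  by split; [exact: supports_face uF|exact: fdim_supports D_neq0].
have FE := card3E (p_poly.2 _ facetF) iF jF kF ij ik jk.
by rewrite -FE.
Qed.

Lemma facet_supports F : facet p F -> exists u, supports p u F.
Proof.
move=> facetF; have F3 := p_poly.2 _ facetF.
have : (2 < #|F|)%N by rewrite F3.
case/card_gt2P => i [j [k [[iF jF kF] [ij jk ki]]]].
apply: (face_supports p_int facetF.1); first by exists i.
have [m m_notin] := exists_other_vertex p_int i j k.
by exists m; rewrite (card3E F3 iF jF kF ij _ jk) // eq_sym.
Qed.

(** The supporting functional is 1 at the three vertices, so with zero determinant Cramer's rule
    makes the sum of their three cross products vanish. That sum is the normal of the triangle,
    which would be degenerate. *)
Lemma facet_det3 i j k : facet p [set i; j; k] ->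
  det3 (p i) (p j) (p k) != 0.
Proof.
move=> facetF; have [u uF] := facet_supports facetF.
have [iF jF kF] : [/\ i \in [set i; j; k]%SET, j \in [set i; j; k]%SET &
   k \in [set i; j; k]%SET] by rewrite !inE !eqxx !orbT.
have ij : i != j.
  apply: contra_eq_neq (p_poly.2 _ facetF) => ->.
  by rewrite finset.setUid cards2; case: (j != k).
apply: contra_eq_neq (facetF.2) => D0.
have : (fdim p [set i; j; k] <= 1)%N.
  apply: fdim_collinear; last first.
    by apply: contraNneq ij => /vertex_inj ->.
  have := det3_rep (p i) (p j) (p k) u.
  rewrite (supports1 uF iF) (supports1 uF jF) (supports1 uF kF) D0 scale0r.
  rewrite !scale1r => ->; apply: vec3P; rewrite /cross !coordE; ring.
by case: fdim => [|[|]].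
Qed.

(** The plane is tilted about the line through [p i] and [p j], towards the side given by the sign
    of [s]; the vertex it meets completes a facet. *)
Lemma facet_at_edge u F i j s : supports p u F -> i \in F -> j \in F ->
  cross (p i) (p j) != 0 -> s != 0 ->
  exists k, facet p [set i; j; k] /\ 0 < s * det3 (p i) (p j) (p k).
Proof.
move=> uF iF jF ij s_neq0.
have [|t [ut_le1 [k k_gt0 k1]]] :=
  @tilt _ _ p u (s *: cross (p i) (p j)) (fun m => (uF m).1).
  by apply: hull_direction => //; rewrite scaler_eq0 negb_or s_neq0.
exists k; rewrite dotZl in k_gt0; split=> //.
have := supports_contact ut_le1 => /supports_facet H.
apply: (proj1 (H i j k _ _ _ _)).
- by rewrite inE !dotDl !dotZl dot_crossl !mulr0 addr0 (supports1 uF iF).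
- by rewrite inE !dotDl !dotZl dot_crossr !mulr0 addr0 (supports1 uF jF).
- by rewrite inE k1.
- by apply: contraTneq k_gt0 => D0; rewrite /det3 in D0; rewrite D0 mulr0 ltxx.
Qed.

Lemma facet_cross i j k : facet p [set i; j; k] -> cross (p i) (p j) != 0.
Proof.
by move=> /facet_det3; apply: contra_neq; rewrite /det3 => ->; rewrite dot0l.
Qed.

Lemma facet_across i j k : facet p [set i; j; k] -> exists l,
  facet p [set i; j; l] /\ det3 (p i) (p j) (p k) * det3 (p i) (p j) (p l) < 0.
Proof.
move=> facetF; have [u uF] := facet_supports facetF.
have [||||l [facetG lt0]] :=
  @facet_at_edge u _ i j (- det3 (p i) (p j) (p k)) uF.
- by rewrite !inE eqxx.
- by rewrite !inE eqxx orbT.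
- exact: facet_cross facetF.
- by rewrite oppr_eq0 facet_det3.
- by exists l; rewrite mulNr oppr_gt0 in lt0.
Qed.

(** With [u] and [v] supporting the two facets, [u - v] vanishes at [p i] and [p j], hence has the
    same sign at [p k] and [p l], which lie on the same side. But it is nonnegative at [p k] and
    nonpositive at [p l], so [v] is 1 at [p k] as well. *)
Lemma facet_side_unique i j k l :
  facet p [set i; j; k] -> facet p [set i; j; l] ->
  0 < det3 (p i) (p j) (p k) * det3 (p i) (p j) (p l) -> k = l.
Proof.
move=> facetF facetG D_gt0.
have [u uF] := facet_supports facetF; have [v vG] := facet_supports facetG.
have [_ ik jk] := det3_distinct (facet_det3 facetF).
have [ui uj] : dot u (p i) = 1 /\ dot u (p j) = 1.
  by split; apply: (supports1 uF); rewrite !inE eqxx ?orbT.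
have uk : dot u (p k) = 1 by apply: (supports1 uF); rewrite !inE eqxx ?orbT.
have [vi vj] : dot v (p i) = 1 /\ dot v (p j) = 1.
  by split; apply: (supports1 vG); rewrite !inE eqxx ?orbT.
have vl : dot v (p l) = 1 by apply: (supports1 vG); rewrite !inE eqxx ?orbT.
have := congr1 (dot^~ (p l)) (det3_rep (p i) (p j) (p k) (u - v)).
rewrite /= !dotBl ui uj uk vi vj !subrr !scale0r !add0r !dotZl dotBl vl.
rewrite -[dot (cross _ _) _]/(det3 (p i) (p j) (p l)) => E.
have [ul _] := uF l; have [vk] := vG k; rewrite !inE => vkE.
have vk1 : dot v (p k) = 1.
  apply/eqP; rewrite eq_le vk /= leNgt; apply/negP => vk_lt1.
  have : 0 < (1 - dot v (p k)) * det3 (p i) (p j) (p l)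
      * det3 (p i) (p j) (p k).
    by rewrite -mulrA mulr_gt0 ?subr_gt0 // mulrC.
  rewrite -E mulrAC -expr2 ltNge mulr_ge0_le0 ?sqr_ge0 //.
  by rewrite subr_le0.
move: vkE; rewrite vk1 eqxx => /esym.
by rewrite (eq_sym k i) (negPf ik) (eq_sym k j) (negPf jk) /= => /eqP.
Qed.

Lemma facet_edge i j k : facet p [set i; j; k] -> edge p i j.
Proof.
move=> facetF; have [l [facetG D_lt0]] := facet_across facetF.
have [u uF] := facet_supports facetF; have [v vG] := facet_supports facetG.
have [ij ik jk] := det3_distinct (facet_det3 facetF).
split=> //; have -> : [set i; j]%SET = ([set i; j; k] :&: [set i; j; l])%SET.
  have kl : k != l.
    by apply: contraTneq D_lt0 => ->; rewrite -expr2 ltNge sqr_ge0.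
  apply/setP => x; rewrite !inE; case: (x == i) => //; case: (x == j) => //=.
  by case: eqP => // ->; rewrite (negPf kl).
exact: supports_face (supports_mean uF vG).
Qed.

Lemma edge_facet i j : edge p i j -> exists k, facet p [set i; j; k].
Proof.
case=> ij face_ij.
have [m m_notin] := exists_other_vertex p_int i j j.
have [||u uF] := face_supports p_int face_ij.
  by exists i; rewrite !inE eqxx.
  by exists m; move: m_notin; rewrite !inE -orbA orbb.
have [iF jF] : i \in [set i; j]%SET /\ j \in [set i; j]%SET.
  by rewrite !inE !eqxx orbT.
have cr : cross (p i) (p j) != 0.
  apply: contra_neq ij => /(supports_cross_eq0 uF iF jF).
  exact: vertex_inj.
have [k [facetF _]] := facet_at_edge uF iF jF cr (oner_neq0 R).
by exists k.
Qed.

(** A plane touching the hull at [p i] alone is tilted about [p i] to a second vertex, then about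
    the line through both. *)
Lemma vertex_facet i : exists j k, facet p [set i; j; k].
Proof.
have [m m_notin] := exists_other_vertex p_int i i i.
have [||u uF] := face_supports p_int (p_poly.1 i).
  by exists i; rewrite inE.
  by exists m; move: m_notin; rewrite !inE !orbb.
have iF : i \in [set i]%SET by rewrite inE.
have [w w_neq0 [wi _]] := exists_orthogonal2 (p i) (p i).
have [|t [ut_le1 [j j_gt0 j1]]] := @tilt _ _ p u w (fun m => (uF m).1).
  exact: hull_direction.
have vG := supports_contact ut_le1.
have iG : i \in contact p (u + t *: w).
  by rewrite inE dotDl dotZl wi mulr0 addr0 (supports1 uF iF).
have jG : j \in contact p (u + t *: w) by rewrite inE j1.
have cr : cross (p i) (p j) != 0.
  apply: contraTneq j_gt0 => /(supports_cross_eq0 vG iG jG) <-.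
  by rewrite wi ltxx.
have [k [facetF _]] := facet_at_edge vG iG jG cr (oner_neq0 R).
by exists j, k.
Qed.

End Polyhedron.
End Facets.

(** * A total order on vectors *)

Section LexicographicOrder.
Context {R : realType}.
Implicit Types (v w : 'cV[R]_3) (a b c : R).

(* Comparing the vertices of the polar dual lexicographically has the effect of
   a linear functional that separates them. *)
Definition lexpos w : bool :=
  (0 < w 0 0) || (w 0 0 == 0) &&
    ((0 < w 1 0) || (w 1 0 == 0) && (0 < w 2%R 0)).

Lemma lexpos_irrefl : lexpos 0 = false.
Proof. by rewrite /lexpos !mxE ltxx eqxx. Qed.

Lemma lexposD v w : lexpos v -> lexpos w -> lexpos (v + w).
Proof.
rewrite /lexpos !coordD.
move=> /orP[v0|/andP[/eqP -> v']] /orP[w0|/andP[/eqP -> w']].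
- by rewrite addr_gt0.
- by rewrite addr0 v0.
- by rewrite add0r w0.
rewrite addr0 ltxx eqxx /=.
move: v' w' => /orP[v1|/andP[/eqP -> v2]] /orP[w1|/andP[/eqP -> w2]].
- by rewrite addr_gt0.
- by rewrite addr0 v1.
- by rewrite add0r w1.
- by rewrite addr0 ltxx eqxx addr_gt0.
Qed.

Lemma lexposZ c w : 0 < c -> lexpos (c *: w) = lexpos w.
Proof.
by move=> c_gt0; rewrite /lexpos !coordZ !pmulr_rgt0 // !mulf_eq0 gt_eqF.
Qed.

Lemma lexpos_total w : w != 0 -> lexpos w || lexpos (- w).
Proof.
apply: contra_neqT; rewrite /lexpos !coordN !oppr_gt0 !oppr_eq0 => lexN.
apply: vec3P; rewrite mxE; move: lexN; case: (ltgtP (w 0 0) 0) => //= _;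
  case: (ltgtP (w 1 0) 0) => //= _; case: (ltgtP (w 2%R 0) 0) => //.
Qed.

Definition lexge0 w : bool := (w == 0) || lexpos w.

Lemma lexge0D v w : lexge0 v -> lexge0 w -> lexge0 (v + w).
Proof.
rewrite /lexge0 => /orP[/eqP ->|v_pos]; first by rewrite add0r.
by move=> /orP[/eqP ->|w_pos]; rewrite ?addr0 ?lexposD ?v_pos ?orbT.
Qed.

Lemma lexge0Z a w : 0 <= a -> lexge0 w -> lexge0 (a *: w).
Proof.
rewrite le_eqVlt => /orP[/eqP <-|a_gt0]; first by rewrite scale0r /lexge0 eqxx.
by rewrite /lexge0 scaler_eq0 gt_eqF // lexposZ.
Qed.

Lemma lexge0_anti w : lexge0 w -> ~~ lexpos (- w).
Proof.
move=> /orP[/eqP ->|w_pos]; first by rewrite oppr0 lexpos_irrefl.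
by apply/negP => /(lexposD w_pos); rewrite subrr lexpos_irrefl.
Qed.

End LexicographicOrder.

(** * The order of the facets and convexity of the polar dual *)

Section FacetOrder.
Context {R : realType} {n : nat} (p : 'I_n -> 'cV[R]_3).
Context (p_poly : triangular_polyhedron p) (p_int : (conv_hull p)° 0).
Implicit Types (F G : {set 'I_n}) (i j k l m : 'I_n).

Lemma facetP F : facet p F -> exists i j k, F = [set i; j; k]%SET.
Proof.
move=> facetF; have F3 := p_poly.2 _ facetF.
have : (2 < #|F|)%N by rewrite F3.
case/card_gt2P => i [j [k [[iF jF kF] [ij jk ki]]]].
by exists i, j, k; rewrite (card3E F3 iF jF kF ij _ jk) // eq_sym.
Qed.

Definition polar F : 'cV[R]_3 := get [set u | supports p u F].

Lemma polarP F : facet p F -> supports p (polar F) F.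
Proof.
move=> /(facet_supports p_poly p_int).
exact: (@getPex _ [set u | supports p u F]).
Qed.

Definition precedes F G : bool := lexpos (polar G - polar F).

(** The position of a facet in the order, counted from 0; the inductions on facets run over it. *)
Definition facet_rank F : nat :=
  #|[set G | `[< facet p G >] && precedes G F]%SET|.

Lemma precedes_rank F G : facet p F ->
  precedes F G -> (facet_rank F < facet_rank G)%N.
Proof.
move=> facetF FG; apply: proper_card; apply/properP; split.
  apply/fintype.subsetP => H; rewrite !inE => /andP[-> /=] HF.
  by move: (lexposD FG HF); rewrite addrA subrK.
exists F; rewrite !inE; first by rewrite FG andbT; apply/asboolP.
by rewrite /precedes subrr lexpos_irrefl andbF.
Qed.

Lemma polar_neq F G : facet p F -> facet p G -> F != G ->
  polar F - polar G != 0.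
Proof.
move=> facetF facetG; apply: contra_neq => /eqP; rewrite subr_eq0 => /eqP FG.
by apply: (supports_inj (polarP facetF)); rewrite FG; apply: polarP.
Qed.

Lemma rank_precedes F G : facet p F -> facet p G ->
  (facet_rank F < facet_rank G)%N -> precedes F G.
Proof.
move=> facetF facetG rk_lt; have FG : G != F.
  by apply: contraTneq rk_lt => ->; rewrite ltnn.
have /orP[//|] := lexpos_total (polar_neq facetG facetF FG).
rewrite opprB => /(precedes_rank facetG) rk_gt.
by have := ltn_trans rk_lt rk_gt; rewrite ltnn.
Qed.

Lemma facet_rank_inj F G : facet p F -> facet p G ->
  facet_rank F = facet_rank G -> F = G.
Proof.
move=> facetF facetG rkE; apply/eqP; apply: contraT => FG.
have /orP[] := lexpos_total (polar_neq facetF facetG FG).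
  by move=> /(precedes_rank facetG); rewrite rkE ltnn.
by rewrite opprB => /(precedes_rank facetF); rewrite rkE ltnn.
Qed.

Lemma adjacent_facet i j k : facet p [set i; j; k] ->
  exists G, [/\ facet p G, i \in G, j \in G & k \notin G].
Proof.
move=> facetF; have [l [facetG D_lt0]] := facet_across p_poly p_int facetF.
have [ij ik jk] := det3_distinct (facet_det3 p_poly p_int facetF).
exists [set i; j; l]%SET; split; rewrite ?inE ?eqxx ?orbT //.
rewrite !negb_or (eq_sym k i) ik (eq_sym k j) jk /=.
by apply: contraTneq D_lt0 => ->; rewrite -expr2 ltNge sqr_ge0.
Qed.

Lemma polar_dot_lt1 F m : facet p F -> m \notin F -> dot (polar F) (p m) < 1.
Proof.
move=> facetF mF; have [le1 eq1] := polarP facetF m.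
by rewrite lt_neqAle eq1 mF.
Qed.

(* The edges of the polar dual at the vertex [polar F] generate a cone that
   contains the polar dual. *)
Lemma polar_cone i j k G1 G2 G3 G : let F := [set i; j; k]%SET in
  facet p F -> facet p G1 -> facet p G2 -> facet p G3 -> facet p G ->
  [/\ i \in G1, j \in G1 & k \notin G1] ->
  [/\ i \in G2, k \in G2 & j \notin G2] ->
  [/\ j \in G3, k \in G3 & i \notin G3] ->
  exists a b c, [/\ 0 <= a, 0 <= b, 0 <= c, (i \in G -> c = 0) &
    polar G - polar F = a *: (polar G1 - polar F) + b *: (polar G2 - polar F)
      + c *: (polar G3 - polar F)].
Proof.
move=> F facetF facet1 facet2 facet3 facetG [i1 j1 k1] [i2 k2 j2] [j3 k3 i3].
have D_neq0 := facet_det3 p_poly p_int facetF.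
have [iF jF kF] : [/\ i \in F, j \in F & k \in F].
  by rewrite !inE !eqxx !orbT.
have dotF m : m \in F -> dot (polar F) (p m) = 1.
  exact: supports1 (polarP facetF).
have in0 H m : facet p H -> m \in F -> m \in H ->
    dot (polar H - polar F) (p m) = 0.
  move=> facetH mF mH.
  by rewrite dotBl dotF // (supports1 (polarP facetH)) ?subrr.
have out H m : facet p H -> m \in F -> m \notin H ->
    dot (polar H - polar F) (p m) < 0.
  by move=> facetH mF mH; rewrite dotBl dotF // subr_lt0 polar_dot_lt1.
have le0 m : m \in F -> dot (polar G - polar F) (p m) <= 0.
  by move=> mF; rewrite dotBl dotF // subr_le0 (polarP facetG m).1.
(* Among the three generators only that of [G1] is nonzero at [p k], only that of [G2] at [p j], and
   only that of [G3] at [p i]. Evaluation there gives each coefficient as a nonpositive number over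
   a negative one. *)
exists (dot (polar G - polar F) (p k) / dot (polar G1 - polar F) (p k)),
  (dot (polar G - polar F) (p j) / dot (polar G2 - polar F) (p j)),
  (dot (polar G - polar F) (p i) / dot (polar G3 - polar F) (p i)).
have quot_ge0 m H : facet p H -> m \in F -> m \notin H ->
    0 <= dot (polar G - polar F) (p m) / dot (polar H - polar F) (p m).
  move=> facetH mF mH; rewrite mulr_le0 ?le0 // invr_le0 ltW //.
  exact: out.
split; [exact: quot_ge0|exact: quot_ge0|exact: quot_ge0| |].
  by move=> iG; rewrite in0 // mul0r.
have nz H m : facet p H -> m \in F -> m \notin H ->
    dot (polar H - polar F) (p m) != 0.
  by move=> *; rewrite lt_eqF // out.
have comb (w w1 w2 w3 v : 'cV[R]_3) a b c :
    dot (w - (a *: w1 + b *: w2 + c *: w3)) v =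
    dot w v - (a * dot w1 v + b * dot w2 v + c * dot w3 v).
  by rewrite dotBl !dotDl !dotZl.
apply/eqP; rewrite -subr_eq0; apply/eqP.
apply: (det3_eq0P D_neq0); rewrite comb.
- rewrite (in0 G1 i) // (in0 G2 i) // !mulr0 !add0r.
  by rewrite divfK ?subrr // nz.
- rewrite (in0 G1 j) // (in0 G3 j) // !mulr0 addr0 add0r.
  by rewrite divfK ?subrr // nz.
- rewrite (in0 G2 k) // (in0 G3 k) // !mulr0 !addr0.
  by rewrite divfK ?subrr // nz.
Qed.

Lemma precedes_irrefl F : ~~ precedes F F.
Proof. by rewrite /precedes subrr lexpos_irrefl. Qed.

Lemma precedesN F G : facet p F -> facet p G -> F != G ->
  ~~ precedes F G -> precedes G F.
Proof.
move=> facetF facetG FG.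
have := lexpos_total (polar_neq facetF facetG FG); rewrite opprB.
by move=> /orP[GF //|F_G] /negP[].
Qed.

Lemma set3C12 i j k : [set i; j; k]%SET = [set j; i; k]%SET.
Proof. by rewrite (finset.setUC [set i]%SET). Qed.

Lemma set3C23 i j k : [set i; j; k]%SET = [set i; k; j]%SET.
Proof. by rewrite -!finset.setUA (finset.setUC [set j]%SET). Qed.

Lemma adjacent_facets i j k : facet p [set i; j; k] -> exists G1 G2 G3,
  [/\ facet p G1, facet p G2 & facet p G3] /\
  [/\ [/\ i \in G1, j \in G1 & k \notin G1],
      [/\ i \in G2, k \in G2 & j \notin G2] &
      [/\ j \in G3, k \in G3 & i \notin G3]].
Proof.
move=> facetF; have [G1 [facet1 i1 j1 k1]] := adjacent_facet facetF.
have [|G2 [facet2 i2 k2 j2]] := @adjacent_facet i k j; first by rewrite set3C23.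
have [|G3 [facet3 j3 k3 i3]] := @adjacent_facet j k i.
  by rewrite set3C23 set3C12.
by exists G1, G2, G3.
Qed.

(** The facets at [p i] form a face of the polar dual: for them the coefficient of [G3] in
    [polar_cone] vanishes, and the two remaining generators decide the comparison. *)
Lemma star_precedes i j k G1 G2 G : let F := [set i; j; k]%SET in
  facet p F -> facet p G1 -> facet p G2 -> facet p G ->
  [/\ i \in G1, j \in G1 & k \notin G1] ->
  [/\ i \in G2, k \in G2 & j \notin G2] ->
  i \in G -> G != F ->
  (precedes G1 F -> precedes G2 F -> precedes G F) /\
  (precedes F G1 -> precedes F G2 -> precedes F G).
Proof.
move=> F facetF facet1 facet2 facetG in1 in2 iG GF.
have [_ [_ [G3 [[_ _ facet3] [_ _ in3]]]]] := adjacent_facets facetF.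
have [a [b [c [a_ge0 b_ge0 _ /(_ iG) ->]]]] :=
  polar_cone facetF facet1 facet2 facet3 facetG in1 in2 in3.
rewrite scale0r addr0 => E; rewrite /precedes.
have GF0 := polar_neq facetG facetF GF.
split=> p1 p2.
  have : lexge0 (polar F - polar G).
    rewrite -opprB E opprD -!scalerN !opprB.
    by rewrite lexge0D // lexge0Z // /lexge0 ?p1 ?p2 orbT.
  by rewrite /lexge0 -opprB oppr_eq0 (negPf GF0).
have : lexge0 (polar G - polar F).
  by rewrite E lexge0D // lexge0Z // /lexge0 ?p1 ?p2 orbT.
by rewrite /lexge0 (negPf GF0).
Qed.

(** As in the simplex method, a local minimum is global: if all three generators of the cone were
    positive, no vertex of the polar dual could be lower. *)
Lemma lower_adjacent_facet i j k G1 G2 G3 G : let F := [set i; j; k]%SET in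
  facet p F -> facet p G1 -> facet p G2 -> facet p G3 -> facet p G ->
  [/\ i \in G1, j \in G1 & k \notin G1] ->
  [/\ i \in G2, k \in G2 & j \notin G2] ->
  [/\ j \in G3, k \in G3 & i \notin G3] -> precedes G F ->
  [|| precedes G1 F, precedes G2 F | precedes G3 F].
Proof.
move=> F facetF facet1 facet2 facet3 facetG in1 in2 in3 GF.
have [a [b [c [a_ge0 b_ge0 c_ge0 _ E]]]] :=
  polar_cone facetF facet1 facet2 facet3 facetG in1 in2 in3.
apply: contraTT GF => /norP[n1 /norP[n2 n3]].
have neqF (H : {set 'I_n}) x : x \in F -> x \notin H -> H != F.
  by move=> xF; apply: contraNneq => ->.
have [iF jF kF] : [/\ i \in F, j \in F & k \in F].
  by rewrite !inE !eqxx !orbT.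
rewrite /precedes -opprB; apply: lexge0_anti; rewrite E.
by rewrite !lexge0D // lexge0Z // /lexge0; apply/orP; right;
  apply: precedesN => //;
  [apply: (neqF _ k)|apply: (neqF _ j)|apply: (neqF _ i)] => //;
  case: in1 in2 in3 => [_ _ ?] [_ _ ?] [_ _ ?].
Qed.

End FacetOrder.

(** * Stationarity of the angle sums *)

Section AngleSum.
Context {R : realType} {n : nat} (p : 'I_n -> 'cV[R]_3).
Context (p_poly : triangular_polyhedron p) (p_int : (conv_hull p)° 0).
Implicit Types (i j k l m : 'I_n) (q : 'I_n -> 'cV[R]_3).

Lemma mulr_sign_trans (a b c : R) :
  a != 0 -> b * c < 0 -> a * b <= 0 -> 0 < a * c.
Proof.
case: (ltgtP a 0) => // a0 _ bc.
  rewrite nmulr_rle0 // nmulr_rgt0 // => b0; rewrite ltNge.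
  by apply: contraTN bc => c0; rewrite -leNgt mulr_ge0.
rewrite pmulr_rle0 // pmulr_rgt0 // => b0; rewrite ltNge.
by apply: contraTN bc => c0; rewrite -leNgt mulr_le0.
Qed.

(** By antisymmetry the sum over ordered pairs is the sum of [g j k * t k] over all pairs, where
    each [t k] has total coefficient 0. *)
Lemma antisymmetric_sum (g : 'I_n -> 'I_n -> R) (t : 'I_n -> R) :
  (forall j k, g k j = - g j k) -> (forall k, \sum_j g j k = 0) ->
  \sum_(jk : 'I_n * 'I_n | (jk.1 < jk.2)%N)
    g jk.1 jk.2 * (t jk.2 - t jk.1) = 0.
Proof.
move=> gN g0.
have swapK : involutive (fun jk : 'I_n * 'I_n => (jk.2, jk.1)) by case.
have gkk k : g k k = 0.
  by have := gN k k; lra.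
under eq_bigr do rewrite mulrBr.
rewrite sumrB -[X in _ - X](_ : \sum_(jk : 'I_n * 'I_n | (jk.2 < jk.1)%N)
   - (g jk.1 jk.2 * t jk.2) = _); last first.
  rewrite (reindex_inj (inv_inj swapK)) /=.
  by apply: eq_bigr => -[j k] _ /=; rewrite gN mulNr opprK.
rewrite sumrN opprK big_mkcond [X in _ + X]big_mkcond -big_split /=.
rewrite (eq_bigr (fun jk => g jk.1 jk.2 * t jk.2)); last first.
  move=> [j k] _ /=; case: ltngtP => [||/val_inj ->]; rewrite ?addr0 ?add0r //.
  by rewrite gkk mul0r.
rewrite -(pair_bigA _ (fun j k => g j k * t k)) exchange_big /=.
by rewrite big1 // => k _; rewrite -mulr_suml g0 mul0r.
Qed.

(** If there is such a facet at all, there are exactly two, on opposite sides of the common edge,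
    and their signs cancel. *)
Lemma facet_sign_sum i k :
  \sum_(j | `[< facet p [set i; j; k] >]) Num.sg (det3 (p i) (p j) (p k)) = 0.
Proof.
have setC3 j l : [set i; j; l]%SET = [set i; l; j]%SET.
  by rewrite -!finset.setUA (finset.setUC [set j]%SET).
have [[j facetF]|no_facet] := pselect (exists j, facet p [set i; j; k]);
  last first.
  by apply: big1 => j /asboolP facetF; case: no_facet; exists j.
rewrite setC3 in facetF.
have [l [facetG D_lt0]] := facet_across p_poly p_int facetF.
have jl : l != j.
  by apply: contraTneq D_lt0 => ->; rewrite -expr2 ltNge sqr_ge0.
rewrite (bigD1 j) /=; last by apply/asboolP; rewrite setC3.
rewrite (bigD1 l) /=; last by rewrite jl andbT; apply/asboolP; rewrite setC3.
rewrite big1 ?addr0; last first.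
  move=> m /andP[/andP[/asboolP facetH mj] ml]; rewrite setC3 in facetH.
  have Dm := facet_det3 p_poly p_int facetH.
  have [D_gt0|] := ltP 0 (det3 (p i) (p k) (p m) * det3 (p i) (p k) (p j)).
    by rewrite (facet_side_unique p_poly p_int facetH facetF D_gt0) eqxx in mj.
  move=> D_le0.
  have : 0 < det3 (p i) (p k) (p m) * det3 (p i) (p k) (p l).
    exact: mulr_sign_trans D_lt0 D_le0.
  move/(facet_side_unique p_poly p_int facetH facetG) => E.
  by rewrite E eqxx in ml.
rewrite (det3C23 (p i) (p k) (p j)) (det3C23 (p i) (p k) (p l)) !sgrN.
have Dj := facet_det3 p_poly p_int facetF.
case: (ltgtP (det3 (p i) (p k) (p j)) 0) Dj => // Dj _.
  have Dl : 0 < det3 (p i) (p k) (p l) by nra.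
  by rewrite ltr0_sg // gtr0_sg // opprK subrr.
have Dl : det3 (p i) (p k) (p l) < 0 by nra.
by rewrite gtr0_sg // ltr0_sg // opprK addNr.
Qed.

Lemma angle_sum_stationary q i :
  \sum_(jk : 'I_n * 'I_n |
        (jk.1 < jk.2)%N && `[< facet p [set i; jk.1; jk.2] >])
    dgram_angle (gram_of p) (dgram_of p q) i jk.1 jk.2 = 0.
Proof.
(* The orientation sign, extended by 0 to pairs that span no facet with [i], puts the sum into
   antisymmetric form with the spins as [t]. *)
pose g j k := if `[< facet p [set i; j; k] >]
  then Num.sg (det3 (p i) (p j) (p k)) else 0.
rewrite big_mkcondr -[RHS](@antisymmetric_sum g (spin p q i)).
- apply: eq_bigr => -[j k] _ /=; rewrite /g.
  case: asboolP => [/(facet_det3 p_poly p_int) D_neq0|_]; last by rewrite mul0r.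
  by rewrite dgram_angle_motion.
- move=> j k; rewrite /g det3C23 sgrN.
  rewrite (_ : [set i; k; j]%SET = [set i; j; k]%SET).
    by case: asboolP; rewrite ?oppr0.
  by rewrite -!finset.setUA (finset.setUC [set k]%SET).
- by move=> k; rewrite -[RHS](facet_sign_sum i k) [RHS]big_mkcond.
Qed.

End AngleSum.

(** * Deformations and the variation of the radii *)

Section Deformations.
Context {R : realType} {n : nat} (p : 'I_n -> 'cV[R]_3).
Context (p_poly : triangular_polyhedron p) (p_int : (conv_hull p)° 0).
Implicit Types (F G : {set 'I_n}) (i j k l m : 'I_n) (q : 'I_n -> 'cV[R]_3)
  (s : 'I_n -> R).

Definition preserves q F : Prop := forall i j, i \in F -> j \in F ->
  dot (p i - p j) (q i - q j) = 0.

(** Under the velocities [q] the distances of the vertices from 0 change at the rates [s]; the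
    division by the norm is cleared. *)
Definition radial q s : Prop := forall i, dot (p i) (q i) = enorm (p i) * s i.

Lemma dot_edge_sym q i j :
  dot (p j - p i) (q j - q i) = dot (p i - p j) (q i - q j).
Proof. by rewrite -(opprB (p i)) -(opprB (q i)) dotNl dotNr opprK. Qed.

Lemma preserves3 q i j k :
  dot (p i - p j) (q i - q j) = 0 -> dot (p i - p k) (q i - q k) = 0 ->
  dot (p j - p k) (q j - q k) = 0 -> preserves q [set i; j; k].
Proof.
move=> ij ik jk x y; rewrite !inE.
by move=> /orP[/orP[]|] /eqP -> /orP[/orP[]|] /eqP ->;
  rewrite ?subrr ?dot0l // dot_edge_sym.
Qed.

(** Two vertices of a triangular facet span an edge, and every edge lies in a facet. This allows
    working facet by facet. *)
Lemma isometricP q :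
  isometric_deformation p q <-> (forall F, facet p F -> preserves q F).
Proof.
split=> [iso F facetF i j iF jF|pres i j]; last first.
  move=> /(edge_facet p_poly p_int)[k /pres].
  by apply; rewrite !inE eqxx ?orbT.
have [->|ij] := eqVneq i j; first by rewrite subrr dot0l.
have F3 := p_poly.2 _ facetF.
have : (0 < #|(F :\ i) :\ j|)%N.
  have := cardsD1 i F; have := cardsD1 j (F :\ i).
  by rewrite !inE eq_sym ij jF iF F3 => ->; case: #|_|.
case/card_gt0P => k; rewrite !inE => /and3P[kj ki kF].
apply/iso/(facet_edge p_poly p_int (k := k)).
by rewrite -(card3E F3 iF jF kF) // eq_sym.
Qed.

Lemma dot_edge_radial q s i j : radial q s ->
  dot (p i - p j) (q i - q j) = dwarped_gram p s i j - dgram_of p q i j.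
Proof.
move=> qs; rewrite /dwarped_gram /dgram_of -!qs !dot_lin.
by rewrite (dotC (q i)); ring.
Qed.

Lemma dgram_preserves q s F i j : radial q s -> preserves q F ->
  i \in F -> j \in F -> dgram_of p q i j = dwarped_gram p s i j.
Proof.
move=> qs qF iF jF; apply/esym/eqP; rewrite -subr_eq0 -dot_edge_radial //.
by rewrite qF.
Qed.

Lemma dgram_angle_preserves q s i j k : radial q s ->
  preserves q [set i; j; k] ->
  dgram_angle (gram_of p) (dgram_of p q) i j k =
  dgram_angle (gram_of p) (dwarped_gram p s) i j k.
Proof.
move=> qs qF; rewrite /dgram_angle /dminor.
have [iF jF kF] : [/\ i \in [set i; j; k]%SET, j \in [set i; j; k]%SET &
   k \in [set i; j; k]%SET] by rewrite !inE !eqxx !orbT.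
by rewrite !(dgram_preserves qs qF).
Qed.

(** The differential of [total_angle] at the initial radii in the direction [s]. *)
Definition angle_sum_variation s i : R :=
  \sum_(jk : 'I_n * 'I_n |
        (jk.1 < jk.2)%N && `[< facet p [set i; jk.1; jk.2] >])
    dgram_angle (gram_of p) (dwarped_gram p s) i jk.1 jk.2.

Lemma curvature_jacobian_mul (s : 'rV[R]_n) i :
  (curvature_jacobian p *m s^T) i 0 = - angle_sum_variation (s 0) i.
Proof.
have nondeg j k := @facet_det3 _ _ _ p_poly p_int i j k.
rewrite mxE.
under eq_bigr do rewrite !mxE derive_curvature // mulNr mulr_suml.
rewrite sumrN exchange_big; congr (- _); apply: eq_bigr => -[j k] _ /=.
rewrite -[X in dgram_angle _ X](_ : (fun x y => \sum_m s 0 m *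
    dwarped_gram p (fun x => (x == m)%:R) x y) = _).
  by rewrite dgram_angle_sum; apply: eq_bigr => m _; rewrite mulrC.
apply/funext => x; apply/funext => y; rewrite /dwarped_gram.
under eq_bigr do rewrite mulrDr !(mulrCA (s 0 _)).
rewrite big_split /= -!mulr_sumr; congr (_ * _ + _ * _).
  rewrite (bigD1 x) //= eqxx mulr1 big1 ?addr0 // => m mx.
  by rewrite eq_sym (negPf mx) mulr0.
rewrite (bigD1 y) //= eqxx mulr1 big1 ?addr0 // => m my.
by rewrite eq_sym (negPf my) mulr0.
Qed.

Lemma isometric_angle_sum q s i : isometric_deformation p q -> radial q s ->
  angle_sum_variation s i = 0.
Proof.
move=> /isometricP iso qs.
rewrite -[RHS](angle_sum_stationary p_poly p_int q i).
apply: eq_bigr => -[j k] /= /andP[_ /asboolP facetF].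
by rewrite (dgram_angle_preserves qs) //; apply: iso.
Qed.

Lemma vertex_neq0 i : p i != 0.
Proof.
have [j [k facetF]] := vertex_facet p_poly p_int i.
exact: det3_neq0 (facet_det3 p_poly p_int facetF).
Qed.

Lemma enorm_neq0 i : enorm (p i) != 0.
Proof. by rewrite lt0r_neq0 // sqrtr_gt0 dot_gt0 vertex_neq0. Qed.

(* Once all the other faces around the vertex [i] are preserved, the vanishing
   of the variation of the angle sum at [i] takes care of the edge opposite to
   [i] in the last one. *)
Lemma last_edge_preserved q s i j k : radial q s ->
  angle_sum_variation s i = 0 -> facet p [set i; j; k] ->
  (forall G, facet p G -> i \in G -> G != [set i; j; k]%SET -> preserves q G) ->
  dot (p i - p j) (q i - q j) = 0 -> dot (p i - p k) (q i - q k) = 0 ->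
  dot (p j - p k) (q j - q k) = 0.
Proof.
(* The angle sum lists each facet at [i] by its increasing pair. *)
wlog jk : j k / (j < k)%N.
  move=> th qs s0 facetF others ij ik.
  have [_ _] := det3_distinct (facet_det3 p_poly p_int facetF).
  rewrite -val_eqE neq_ltn => /orP[jk|kj]; first exact: th.
  rewrite dot_edge_sym; rewrite set3C23 in facetF others.
  exact: (th k j).
move=> qs s0 facetF others ij ik.
have D_neq0 := facet_det3 p_poly p_int facetF.
have ineq : 0 < minor (gram_of p) i j j * minor (gram_of p) i k k
    - minor (gram_of p) i j k ^+ 2.
  rewrite !minor_gram_of -gram_det3 mulr_gt0 ?exprn_even_gt0 //.
  by rewrite dot_gt0 vertex_neq0.
have H x y : dot (p x - p y) (q x - q y) = 0 ->
    dgram_of p q x y = dwarped_gram p s x y.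
  by move=> /eqP; rewrite (dot_edge_radial _ _ qs) subr_eq0 => /eqP.
have Hxx x : dgram_of p q x x = dwarped_gram p s x x.
  by apply: H; rewrite subrr dot0l.
rewrite (dot_edge_radial _ _ qs); apply/eqP; rewrite subr_eq0 eq_sym; apply/eqP.
apply: (dgram_angle_inj (G := gram_of p) (i := i)) => //.
- by rewrite /gram_of dot_eq0 vertex_neq0.
- exact: H.
- exact: H.
(* Both angle sums vanish, along [q] by stationarity and along [s] by hypothesis. Their terms agree
   outside the pair [(j, k)], hence at that pair too. *)
have := etrans (angle_sum_stationary p_poly p_int q i) (esym s0).
rewrite /angle_sum_variation (bigD1 (j, k)) /=;
  last by rewrite jk; apply/asboolP.
rewrite [RHS](bigD1 (j, k)) /=; last by rewrite jk; apply/asboolP.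
rewrite (eq_bigr (fun jk =>
  dgram_angle (gram_of p) (dwarped_gram p s) i jk.1 jk.2)).
  exact: addIr.
move=> -[j' k'] /= /andP[/andP[jk' /asboolP facetG] jk_neq].
rewrite (dgram_angle_preserves qs) //; apply: others => //.
  by rewrite !inE eqxx.
(* An increasing pair is determined by the facet it completes. *)
apply: contraNneq jk_neq => GF.
have [ij_neq ik_neq _] := det3_distinct D_neq0.
have : j \in [set i; j'; k']%SET by rewrite GF !inE eqxx orbT.
have : k \in [set i; j'; k']%SET by rewrite GF !inE eqxx orbT.
rewrite !inE (eq_sym j) (negPf ij_neq) (eq_sym k) (negPf ik_neq) /=.
rewrite -!val_eqE xpair_eqE -!val_eqE.
move: jk jk' => /= jk jk' /orP[] /eqP kE /orP[] /eqP jE; lia.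
Qed.

End Deformations.

(** * Construction of an isometric deformation with given radial rates *)

Section Existence.
Context {R : realType} {n : nat} (p : 'I_n -> 'cV[R]_3).
Context (p_poly : triangular_polyhedron p) (p_int : (conv_hull p)° 0).
Implicit Types (F G : {set 'I_n}) (i j k l m : 'I_n) (q : 'I_n -> 'cV[R]_3)
  (s : 'I_n -> R).

Local Notation facet_rank := (facet_rank p).

Definition preserves_below q N : Prop :=
  forall F, facet p F -> (facet_rank F < N)%N -> preserves p q F.

Definition update q k (x : 'cV[R]_3) m := if m == k then x else q m.

Lemma update_preserves q k x F : preserves p q F -> k \notin F ->
  preserves p (update q k x) F.
Proof.
move=> qF kF i j iF jF; rewrite /update.
have neq m : m \in F -> m == k = false.
  by move=> mF; apply: contraNF kF => /eqP <-.
by rewrite !neq // qF.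
Qed.

(** The conditions on the velocity [x] of [p k] are three linear equations with normals [p i], [p j]
    and [p k]. *)
Lemma move_vertex q s i j k : det3 (p i) (p j) (p k) != 0 -> radial p q s ->
  exists x, [/\ radial p (update q k x) s,
    dot (p i - p k) (update q k x i - update q k x k) = 0 &
    dot (p j - p k) (update q k x j - update q k x k) = 0].
Proof.
move=> D_neq0 qs; have [_ ik jk] := det3_distinct D_neq0.
have [x [xi xj xk]] := det3_solve
  (enorm (p k) * s k + dot (p i - p k) (q i))
  (enorm (p k) * s k + dot (p j - p k) (q j)) (enorm (p k) * s k) D_neq0.
exists x; rewrite /update eqxx (negPf ik) (negPf jk); split.
- by move=> m; case: eqP => [->|_].
- by rewrite dotBr [X in _ - X]dotBl xi xk; ring.
- by rewrite dotBr [X in _ - X]dotBl xj xk; ring.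
Qed.

Lemma extend_two_lower q s N i j k G1 G2 : let F := [set i; j; k]%SET in
  radial p q s -> angle_sum_variation p s i = 0 -> preserves_below q N ->
  facet p F -> facet p G1 -> facet p G2 -> facet_rank F = N ->
  [/\ i \in G1, j \in G1 & k \notin G1] ->
  [/\ i \in G2, k \in G2 & j \notin G2] ->
  precedes p G1 F -> precedes p G2 F -> preserves p q F.
Proof.
move=> F qs s0 qN facetF facet1 facet2 rkF in1 in2 lt1 lt2.
have below G : facet p G -> precedes p G F -> preserves p q G.
  by move=> facetG GF; apply: qN => //; rewrite -rkF precedes_rank.
have ij : dot (p i - p j) (q i - q j) = 0.
  by case: in1 => i1 j1 _; apply: (below G1).
have ik : dot (p i - p k) (q i - q k) = 0.
  by case: in2 => i2 k2 _; apply: (below G2).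
apply: preserves3 => //; apply: (last_edge_preserved p_poly p_int qs s0) => //.
move=> G facetG iG GF; apply: below => //.
exact: (star_precedes p_poly p_int facetF facet1 facet2 facetG in1 in2 iG GF).1.
Qed.

Lemma extend_two_higher q s N i j k G1 G2 G3 : let F := [set i; j; k]%SET in
  radial p q s -> preserves_below q N ->
  facet p F -> facet p G1 -> facet p G2 -> facet p G3 -> facet_rank F = N ->
  [/\ i \in G1, j \in G1 & k \notin G1] ->
  [/\ i \in G2, k \in G2 & j \notin G2] ->
  [/\ j \in G3, k \in G3 & i \notin G3] ->
  ~~ precedes p G2 F -> ~~ precedes p G3 F ->
  exists q', [/\ radial p q' s, preserves_below q' N & preserves p q' F].
Proof.
move=> F qs qN facetF facet1 facet2 facet3 rkF in1 in2 in3 ge2 ge3.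
have D_neq0 := facet_det3 p_poly p_int facetF.
have [ij ik jk] := det3_distinct D_neq0.
have [iF jF kF] : [/\ i \in F, j \in F & k \in F].
  by rewrite !inE !eqxx !orbT.
have kF' : F = [set k; i; j]%SET by rewrite /F set3C23 set3C12.
(* [G2] and [G3] are the neighbours of [F] at the corner [k]; as both are higher, [star_precedes]
   puts every other facet at [k] above [F]. *)
have k_fresh G : facet p G -> precedes p G F -> k \notin G.
  move=> facetG GF; apply/negP => kG.
  have GF_neq : G != F.
    by apply: contraTneq GF => ->; apply: precedes_irrefl.
  have [i2 k2 j2] := in2; have [j3 k3 i3] := in3.
  have neqF (H : {set 'I_n}) x : x \in F -> x \notin H -> H != F.
    by move=> xF; apply: contraNneq => ->.
  have FG2 : precedes p F G2 by apply: precedesN => //; apply: (neqF _ j).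
  have FG3 : precedes p F G3 by apply: precedesN => //; apply: (neqF _ i).
  rewrite kF' in facetF GF_neq FG2 FG3 GF.
  have [_ /(_ FG2 FG3) FG] := star_precedes p_poly p_int facetF facet2 facet3
    facetG (And3 k2 i2 j2) (And3 k3 j3 i3) kG GF_neq.
  have := ltn_trans (precedes_rank facetG GF) (precedes_rank facetF FG).
  by rewrite ltnn.
have below G : facet p G -> (facet_rank G < N)%N -> precedes p G F.
  by move=> facetG; rewrite -rkF; apply: rank_precedes.
have [q1 [q1s q1N q1ij]] : exists q1, [/\ radial p q1 s, preserves_below q1 N &
    dot (p i - p j) (q1 i - q1 j) = 0].
  have [lt1|ge1] := boolP (precedes p G1 F).
    exists q; split=> //; case: in1 => i1 j1 _.
    by apply: (qN G1) => //; rewrite -rkF precedes_rank.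
  (* With all three neighbours higher, [F] is the lowest facet. There is nothing below it to
     destroy, so [q j] may be changed as well. *)
  have [|x [xs xij _]] := @move_vertex q s i k j _ qs.
    by rewrite det3C23 oppr_eq0.
  exists (update q j x); split=> // G facetG /(below _ facetG) GF.
  have := lower_adjacent_facet p_poly p_int facetF facet1 facet2 facet3 facetG
    in1 in2 in3 GF.
  by rewrite (negPf ge1) (negPf ge2) (negPf ge3).
have [x [xs xik xjk]] := move_vertex D_neq0 q1s.
exists (update q1 k x); split=> //.
  move=> G facetG rkG; apply: update_preserves; first exact: q1N.
  by apply: k_fresh => //; apply: below.
by apply: preserves3 => //; rewrite /update (negPf ik) (negPf jk).
Qed.

Lemma exists_deformation s : (forall i, angle_sum_variation p s i = 0) ->
  exists2 q, isometric_deformation p q & radial p q s.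
Proof.
move=> s0.
suff [q qs qN] : exists2 q, radial p q s &
    preserves_below q (\max_F facet_rank F).+1.
  exists q => //; apply/(isometricP p_poly p_int) => F facetF.
  by apply: qN => //; rewrite ltnS (leq_bigmax F).
elim: (\max_F facet_rank F).+1 => [|N [q qs qN]].
  (* Before any facet is treated, each vertex moves along its ray at the prescribed rate. *)
  exists (fun i => (s i / enorm (p i)) *: p i) => // i.
  rewrite dotZr -sqr_enorm; have := enorm_neq0 p_poly p_int i.
  by move=> ?; field.
have [[F [facetF rkF]]|no_facet] :=
  pselect (exists F, facet p F /\ facet_rank F = N); last first.
  exists q => // F facetF; rewrite ltnS leq_eqVlt.
  move=> /orP[/eqP rkF|]; last exact: qN.
  by case: no_facet; exists F.
suff [q' [q's q'N q'F]] :
    exists q', [/\ radial p q' s, preserves_below q' N & preserves p q' F].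
  exists q' => // G facetG; rewrite ltnS leq_eqVlt.
  move=> /orP[/eqP rkG|]; last exact: q'N.
  by rewrite (facet_rank_inj p_poly p_int facetG facetF) // rkG.
have [i [j [k FE]]] := facetP p_poly facetF.
rewrite FE in facetF rkF *.
have [G1 [G2 [G3 [[facet1 facet2 facet3] [in1 in2 in3]]]]] :=
  adjacent_facets p_poly p_int facetF.
have [i1 j1 k1] := in1; have [i2 k2 j2] := in2; have [j3 k3 i3] := in3.
have Ej : [set i; j; k]%SET = [set j; i; k]%SET by rewrite set3C12.
have Ej' : [set i; j; k]%SET = [set i; k; j]%SET by rewrite set3C23.
have Ek : [set i; j; k]%SET = [set k; i; j]%SET by rewrite set3C23 set3C12.
have Ei : [set i; j; k]%SET = [set j; k; i]%SET by rewrite set3C12 set3C23.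
(* Two of the three neighbours are on the same side of the order. The corner they share is [i] for
   [G1] and [G2], [j] for [G1] and [G3], [k] for [G2] and [G3], and the facet is relabelled
   accordingly. *)
have [lt1|ge1] := boolP (precedes p G1 [set i; j; k]);
have [lt2|ge2] := boolP (precedes p G2 [set i; j; k]);
have [lt3|ge3] := boolP (precedes p G3 [set i; j; k]).
- exists q; split=> //.
  exact: (extend_two_lower qs (s0 i) qN facetF facet1 facet2 rkF in1 in2).
- exists q; split=> //.
  exact: (extend_two_lower qs (s0 i) qN facetF facet1 facet2 rkF in1 in2).
- exists q; split=> //; rewrite Ej in facetF rkF lt1 lt3 *.
  by apply: (extend_two_lower qs (s0 j) qN facetF facet1 facet3 rkF).
- exact: (extend_two_higher qs qN facetF facet1 facet2 facet3 rkF in1 in2 in3).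
- exists q; split=> //; rewrite Ek in facetF rkF lt2 lt3 *.
  by apply: (extend_two_lower qs (s0 k) qN facetF facet2 facet3 rkF).
- rewrite Ej' in facetF rkF ge1 ge3 *.
  by apply: (extend_two_higher qs qN facetF facet2 facet1 facet3 rkF).
- rewrite Ei in facetF rkF ge1 ge2 *.
  by apply: (extend_two_higher qs qN facetF facet3 facet1 facet2 rkF).
- exact: (extend_two_higher qs qN facetF facet1 facet2 facet3 rkF in1 in2 in3).
Qed.

End Existence.

(** * Rotations, translations and the kernel of the Jacobian *)

Section Rotations.
Context {R : realType} {n : nat} (p : 'I_n -> 'cV[R]_3).
Context (p_poly : triangular_polyhedron p) (p_int : (conv_hull p)° 0).
Implicit Types (F G : {set 'I_n}) (i j k l m : 'I_n) (q : 'I_n -> 'cV[R]_3)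
  (s : 'I_n -> R) (A : 'M[R]_3).

Lemma dot_mulmx (x y : 'cV[R]_3) : dot x y = (x^T *m y) 0 0.
Proof. by rewrite mxE; apply: eq_bigr => i _; rewrite mxE. Qed.

Lemma skew_dot A (x : 'cV[R]_3) : A^T = - A -> dot x (A *m x) = 0.
Proof.
move=> skewA; have : dot x (A *m x) = - dot x (A *m x).
  by rewrite {1}dotC !dot_mulmx trmx_mul skewA mulmxN mulNmx mxE mulmxA.
by move=> ?; lra.
Qed.

(** With the positions and velocities as columns of [P] and [Q], the matrix is [Q *m invmx P]. It is
    congruent to [P^T *m Q], which is skew because lengths and radii are preserved. *)
Lemma exists_skew q i j k : det3 (p i) (p j) (p k) != 0 ->
  radial p q (fun=> 0) -> preserves p q [set i; j; k] ->
  exists2 A, A^T = - A & forall m, m \in [set i; j; k]%SET -> q m = A *m p m.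
Proof.
move=> D_neq0 q0 qF.
pose f := tnth [tuple i; j; k].
have fP m : m \in [set i; j; k]%SET -> exists a, m = f a.
  rewrite !inE => /orP[/orP[]|] /eqP ->; [exists 0|exists 1|exists 2%R];
  by rewrite /f (tnth_nth i).
have fF a : f a \in [set i; j; k]%SET.
  have : f a \in [tuple i; j; k] by apply: mem_tnth.
  by rewrite !inE -orbA.
pose P : 'M[R]_3 := \matrix_(a, b) p (f b) a 0.
pose Q : 'M[R]_3 := \matrix_(a, b) q (f b) a 0.
have P_unit : P \in unitmx.
  rewrite -row_free_unit; apply: inj_row_free => v vP0.
  have dot0 a : dot v^T (p (f a)) = 0.
    have := congr1 (fun M : 'rV[R]_3 => M 0 a) vP0; rewrite !mxE => E.
    by rewrite -[RHS]E /dot; apply: eq_bigr => b _; rewrite !mxE.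
  apply/eqP; rewrite -trmx_eq0; apply/eqP; apply: (det3_eq0P D_neq0).
  - exact: (dot0 0).
  - exact: (dot0 1).
  - exact: (dot0 2%R).
exists (Q *m invmx P); last first.
  move=> m /fP[a ->].
  have entriesE (g : 'I_n -> 'cV[R]_3) :
      g (f a) = col a (\matrix_(x, b) g (f b) x 0).
    by apply/matrixP => x y; rewrite !mxE ord1.
  by rewrite (entriesE q) (entriesE p) -/P -/Q !colE mulmxA mulmxKV.
pose S := P^T *m Q.
have SE a b : S a b = dot (p (f a)) (q (f b)).
  by rewrite mxE /dot; apply: eq_bigr => c _; rewrite !mxE.
have S_skew : S^T = - S.
  apply/matrixP => a b; rewrite mxE [RHS]mxE !SE.
  have := qF _ _ (fF a) (fF b); rewrite (dot_edge_radial _ _ q0).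
  by rewrite /dwarped_gram !mulr0 addr0 /dgram_of (dotC (q (f a))); lra.
have AE : Q *m invmx P = (invmx P)^T *m S *m invmx P.
  by rewrite /S mulmxA -trmx_mul mulmxV // trmx1 mul1mx.
by clearbody S; rewrite AE !trmx_mul trmxK S_skew mulNmx mulmxN mulmxA.
Qed.

(** Any other facet has a lower neighbour, with which it shares two vertices where [q] already
    vanishes. The velocity of the third vertex is then orthogonal to all three vertices of the
    facet, hence 0. *)
Lemma radial0_zero q F0 : radial p q (fun=> 0) -> isometric_deformation p q ->
  facet p F0 ->
  (forall F, facet p F -> (facet_rank p F0 <= facet_rank p F)%N) ->
  (forall m, m \in F0 -> q m = 0) -> forall m, q m = 0.
Proof.
move=> q0 /(isometricP p_poly p_int) iso facetF0 F0_min q_F0.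
suff vanish N F : facet p F -> (facet_rank p F < N)%N ->
    forall m, m \in F -> q m = 0.
  move=> m; have [j [k facetF]] := vertex_facet p_poly p_int m.
  by apply: (vanish _ _ facetF (ltnSn _)); rewrite !inE eqxx.
elim: N F => [//|N IH] F facetF; rewrite ltnS => rkF.
have [->|F_neq] := eqVneq F F0; first exact: q_F0.
have F0F : precedes p F0 F.
  apply: rank_precedes => //; rewrite ltn_neqAle F0_min // andbT.
  by apply: contra_neq F_neq => /facet_rank_inj ->.
have lastv i j k G :
    facet p [set i; j; k] -> (facet_rank p [set i; j; k] <= N)%N ->
    facet p G -> precedes p G [set i; j; k] -> i \in G -> j \in G ->
    forall m, m \in [set i; j; k]%SET -> q m = 0.
  move=> facetH rkH facetG GH iG jG.
  have rkG := leq_trans (precedes_rank facetG GH) rkH.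
  have [qi qj] := (IH _ facetG rkG _ iG, IH _ facetG rkG _ jG).
  have [iH jH kH] : [/\ i \in [set i; j; k]%SET, j \in [set i; j; k]%SET &
    k \in [set i; j; k]%SET] by rewrite !inE !eqxx !orbT.
  have qk_k : dot (q k) (p k) = 0 by rewrite dotC q0 mulr0.
  have qk : q k = 0.
    have qk_i := iso _ facetH _ _ kH iH; have qk_j := iso _ facetH _ _ kH jH.
    rewrite qi subr0 dotC dotBr qk_k sub0r in qk_i.
    rewrite qj subr0 dotC dotBr qk_k sub0r in qk_j.
    by apply: (det3_eq0P (facet_det3 p_poly p_int facetH)) => //;
      apply: oppr_inj; rewrite oppr0.
  by move=> m; rewrite !inE => /orP[/orP[]|] /eqP ->.
have [i [j [k FE]]] := facetP p_poly facetF.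
rewrite FE in facetF rkF F0F *.
have [G1 [G2 [G3 [[facet1 facet2 facet3] [in1 in2 in3]]]]] :=
  adjacent_facets p_poly p_int facetF.
have /or3P := lower_adjacent_facet p_poly p_int facetF facet1 facet2 facet3
  facetF0 in1 in2 in3 F0F.
have [i1 j1 _] := in1; have [i2 k2 _] := in2; have [j3 k3 _] := in3.
case=> lt; first exact: (lastv i j k G1).
  by rewrite set3C23 in facetF rkF lt *; apply: (lastv i k j G2).
rewrite set3C12 set3C23 in facetF rkF lt *; exact: (lastv j k i G3).
Qed.

(** The rotation found on the lowest facet is subtracted; what remains vanishes on that facet, hence
    everywhere. *)
Lemma radial0_rotation q : radial p q (fun=> 0) -> isometric_deformation p q ->
  exists2 A, A^T = - A & forall i, q i = A *m p i.
Proof.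
move=> q0 iso.
have [m _] : exists m, 0 < dot (const_mx 1) (p m).
  apply: hull_direction => //; apply/eqP => /matrixP/(_ 0 0) /eqP.
  by rewrite !mxE oner_eq0.
have [j [k /asboolP facetG]] := vertex_facet p_poly p_int m.
have [F0 /asboolP facetF0 F0_min] := 
  @arg_minnP _ [set m; j; k]%SET (fun F => `[< facet p F >]) (facet_rank p)
    facetG.
have [a [b [c F0E]]] := facetP p_poly facetF0.
have facet_abc : facet p [set a; b; c] by rewrite -F0E.
have /isometricP := iso => /(_ p_poly p_int _ facet_abc) q_abc.
have [A skewA qA] := exists_skew (facet_det3 p_poly p_int facet_abc) q0 q_abc.
exists A => // i; apply/eqP; rewrite -subr_eq0; apply/eqP.
apply: (@radial0_zero (fun i => q i - A *m p i) F0) => //.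
- by move=> l; rewrite dotBr q0 skew_dot // subr0.
- move=> x y /iso xy.
  rewrite [X in dot _ X](_ : _ = q x - q y - A *m (p x - p y)).
    by rewrite dotBr xy skew_dot // subr0.
  by rewrite mulmxBr !opprD addrACA.
- by move=> F /asboolP/F0_min.
- by move=> l; rewrite F0E => /qA ->; rewrite subrr.
Qed.

Lemma orthogonal_to_vertices (b : 'cV[R]_3) :
  (forall i, dot b (p i) = 0) -> b = 0.
Proof.
move=> b0; apply/eqP; apply: contraT => /(hull_direction p_int)[m].
by rewrite b0 ltxx.
Qed.

Lemma curvature_kernelP (v : 'rV[R]_n) :
  (v <= kermx (curvature_jacobian p)^T)%MS <->
  exists2 q, isometric_deformation p q & radial p q (v 0).
Proof.
have -> : (v <= kermx (curvature_jacobian p)^T)%MS <->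
    forall i, angle_sum_variation p (v 0) i = 0.
  split=> [/sub_kermxP vJ i|s0].
    have := curvature_jacobian_mul p_poly p_int v i.
    have -> : curvature_jacobian p *m v^T = 0.
      by rewrite -[LHS]trmxK trmx_mul trmxK vJ trmx0.
    by rewrite mxE => /eqP; rewrite eq_sym oppr_eq0 => /eqP.
  apply/sub_kermxP; rewrite -[LHS]trmxK trmx_mul trmxK.
  suff -> : curvature_jacobian p *m v^T = 0 by rewrite trmx0.
  apply/matrixP => i a; rewrite ord1 (curvature_jacobian_mul p_poly p_int).
  by rewrite s0 oppr0 mxE.
split=> [/(exists_deformation p_poly p_int)//|[q iso qv] i].
exact: (isometric_angle_sum p_poly p_int i iso qv).
Qed.

(** Row [a] lists the rates of the radii under the unit translation along axis [a]. *)
Definition translation_mx : 'M[R]_(3, n) :=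
  \matrix_(a, i) (p i a 0 / enorm (p i)).

Lemma translation_mxE (b : 'rV[R]_3) i :
  (b *m translation_mx) 0 i = dot b^T (p i) / enorm (p i).
Proof.
by rewrite mxE /dot mulr_suml; apply: eq_bigr => a _; rewrite !mxE mulrA.
Qed.

Lemma translation_mx_rank : \rank translation_mx = 3%N.
Proof.
apply/eqP/inj_row_free => b bT.
apply/eqP; rewrite -trmx_eq0; apply/eqP/orthogonal_to_vertices => i.
have := translation_mxE b i; rewrite bT mxE => /esym/eqP.
by rewrite mulf_eq0 invr_eq0 (negPf (enorm_neq0 p_poly p_int i)) orbF => /eqP.
Qed.

Lemma translation_mx_kernel :
  (translation_mx <= kermx (curvature_jacobian p)^T)%MS.
Proof.
apply/rV_subP => v /submxP[b vE]; apply/curvature_kernelP.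
exists (fun=> b^T); first by move=> i j _; rewrite subrr dotC dot0l.
move=> i; rewrite vE translation_mxE mulrC divfK ?enorm_neq0 //.
exact: dotC.
Qed.

End Rotations.

(** * Comparison of the kernel with the translations *)

Theorem lemma3p5 (R : realType) (n : nat) (p : 'I_n -> 'cV[R]_3)
    (p_poly : triangular_polyhedron p)
    (p_int : (conv_hull p)° 0) :
  infinitesimally_rigid p <-> dim_ker (curvature_jacobian p) = 3%N.
Proof.
(* The row space of [T] has dimension 3 and always lies in [K], so the dimension condition means
   that every isometric deformation changes the radii as some translation does. *)
pose T := translation_mx p; pose K := kermx (curvature_jacobian p)^T.
have TK : (T <= K)%MS := translation_mx_kernel p_poly p_int.
have Trank : \rank T = 3%N := translation_mx_rank p_poly p_int.
rewrite /dim_ker -/K; split=> [rigid|Krank].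
  apply/eqP; rewrite eqn_leq -{2}Trank mxrankS // andbT -Trank mxrankS //.
  apply/rV_subP => v /(curvature_kernelP p_poly p_int)[q iso qv].
  have [A [b [skewA qE]]] := rigid q iso.
  (* The rotational part [A] leaves the radii stationary, so only the translation by [b] contributes
     to [v]. *)
  suff -> : v = b^T *m T by apply: submxMl.
  apply/rowP => i; rewrite translation_mxE trmxK.
  have r_neq0 := enorm_neq0 p_poly p_int i.
  apply: (mulfI r_neq0); rewrite -qv qE dotDr skew_dot // add0r.
  by rewrite mulrCA divff // mulr1 dotC.
have KT : (K <= T)%MS.
  by rewrite -(mxrank_leqif_sup TK).2 Trank Krank.
move=> q iso; pose v : 'rV[R]_n := \row_i (dot (p i) (q i) / enorm (p i)).
have qv : radial p q (v 0).
  by move=> i; rewrite mxE mulrC divfK // enorm_neq0.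
have vK : (v <= K)%MS by apply/(curvature_kernelP p_poly p_int); exists q.
have /submxP[b vE] := submx_trans vK KT.
(* Subtracting the translation with the same radial rates leaves an isometric deformation with
   stationary radii, which is a rotation. *)
have [|i j /iso ij|A skewA qA] :=
  @radial0_rotation _ _ p p_poly p_int (fun i => q i - b^T).
- move=> i; rewrite mulr0 dotBr qv vE translation_mxE mulrC.
  rewrite divfK ?enorm_neq0 //.
  by rewrite dotC subrr.
- by rewrite opprB addrA subrK.
by exists A, b^T; split=> // i; rewrite -qA subrK.
Qed.
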